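(* Let $(X,\varphi)$ and $(Y,\psi)$ be Cantor minimal systems, and let $x\in X$ and $y\in Y$. Let $C$ and $B$ be Bratteli–Vershik models for $(X,\varphi,x)$ and $(Y,\psi,y)$, respectively. The following statements are equivalent: (1) there is a factor map $\alpha:(X,\varphi)\to(Y,\psi)$ with $\alpha(x)=y$; (2) there is an ordered premorphism $f$ from $B$ to $C$. More precisely, identifying $(X,\varphi,x)$ with $(X_C,\lambda_C,x_{\max})$ and $(Y,\psi,y)$ with $(X_B,\lambda_B,x_{\max})$ via fixed pointed conjugacies, $[f]\mapsto\mathcal{V}([f])$ is a one-to-one correspondence between the set of equivalence classes $[f]$ of ordered premorphisms $f$ from $B$ to $C$ and the set of factor maps $\alpha$ as in (1).
   Context: A Cantor minimal system $(X,\varphi)$ is a minimal homeomorphism $\varphi$ of a space $X$ homeomorphic to the Cantor set. A factor map $(X,\varphi)\to(Y,\psi)$ is a continuous surjection $\alpha:X\to Y$ with $\alpha\circ\varphi=\psi\circ\alpha$. **Bratteli diagrams.** A Bratteli diagram $(V,E)$ consists of a vertex set $V=V_0\sqcup V_1\sqcup\cdots$ with each $V_n$ finite and non-empty and $V_0$ a singleton, and an edge set $E=E_1\sqcup E_2\sqcup\cdots$ with each $E_n$ finite and non-empty, together with maps $r,s:E\to V$ (range, source) such that $r(E_n)\subseteq V_n$, $s(E_n)\subseteq V_{n-1}$, $s^{-1}\{v\}\neq\varnothing$ for all $v\in V$ and $r^{-1}\{v\}\ne\varnothing$ for all $v\in V\setminus V_0$. An ordered Bratteli diagram $(V,E,\geq)$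 is a Bratteli diagram with a partial order on $E$ such that $e,e'$ are comparable iff $r(e)=r(e')$. It is properly ordered if there is exactly one infinite path $x_{\max}=(e_1,e_2,\ldots)$ ($e_i\in E_i$, $r(e_i)=s(e_{i+1})$) consisting of maximal edges, and exactly one, $x_{\min}$, consisting of minimal edges. For $B$ properly ordered, $X_B$ is the space of infinite paths, with the cylinder sets as a basis of the topology, and the Vershik homeomorphism $\lambda_B$ is given by $\lambda_B(x_{\max})=x_{\min}$ and, for other $x=(e_1,e_2,\ldots)$, with $k$ least such that $e_k$ is not maximal, $f_k$ the successor of $e_k$ in $r^{-1}\{r(e_k)\}$ and $(f_1,\ldots,f_{k-1})$ the path of minimal edges from $V_0$ to $s(f_k)$, by $\lambda_B(x)=(f_1,\ldots,f_k,e_{k+1},\ldots)$. **Bratteli–Vershik models.** A Bratteli–Vershik model for $(X,\varphi,x_0)$ is a properly ordered Bratteli diagram $B$ for which there is a homeomorphism $\theta:X\to X_B$ with $\theta\circ\varphi=\lambda_B\circ\theta$ and $\theta(x_0)=x_{\max}$ (a pointed conjugacy). **Edge sets.** An ordered edge set from a finite set $S$ to a finite set $T$ is a finite set $F$ with maps $s:F\to S$, $r:F\to T$ and a linear order on each $r^{-1}\{w\}$, $w\in T$. If $G$ is an ordered edge set from $T$ to $U$, then $F\circ G=\{(e,g)\in F\times G: r(e)=s(g)\}$, with source $s(e)$, range $r(g)$, and order: for $r(g)=r(g')$, $(e,g)<(e',g')$ iff $g<g'$, or $g=g'$ and $e<e'$. Write $F\cong F'$ if there is a (necessarily unique) bijection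 $F\to F'$ preserving sources, ranges and order. For $k<l$, $E_{k,l}=E_{k+1}\circ\cdots\circ E_l$; $E_{k,k}$ consists of one edge from $v$ to $v$ for each $v\in V_k$. **Ordered premorphisms.** An ordered premorphism $f:B=(V,E,\ge)\to C=(W,S,\ge)$ is a triple $(F,(f_n)_{n\ge0},\geq)$ where $(f_n)$ is an unbounded sequence of integers with $0=f_0\le f_1\le\cdots$, and $F=F_0\sqcup F_1\sqcup\cdots$ where each $F_n$ is a non-empty finite ordered edge set from $V_n$ to $W_{f_n}$ such that every $v\in V_n$ is the source and every $w\in W_{f_n}$ the range of some edge of $F_n$, $F_0$ is a singleton, and $E_{n+1}\circ F_{n+1}\cong F_n\circ S_{f_n,f_{n+1}}$ for all $n\ge0$. Premorphisms $f=(F,(f_n),\ge)$, $g=(G,(g_n),\ge)$ from $B$ to $C$ are equivalent if there are positive integers $n_1<m_1<n_2<m_2<\cdots$ with $f_{n_k}<g_{m_k}<f_{n_{k+1}}$ and, for all $k\ge1$, $E_{n_k,m_k}\circ G_{m_k}\cong F_{n_k}\circ S_{f_{n_k},g_{m_k}}$ and $E_{m_k,n_{k+1}}\circ F_{n_{k+1}}\cong G_{m_k}\circ S_{g_{m_k},f_{n_{k+1}}}$; $[f]$ denotes the class of $f$. **The map $\mathcal{V}([f])$.** For an ordered premorphism $f=(F,(f_n)_{n\ge0},\geq)$ from a properly ordered Bratteli diagram $B=(V,E,\ge)$ to a properly ordered Bratteli diagram $C=(W,S,\ge)$, with $F=F_0\sqcup F_1\sqcup\cdots$ and each $F_n$ an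 ordered edge set from $V_n$ to $W_{f_n}$, $\mathcal{V}([f]):X_C\to X_B$ is the following map (depending only on $[f]$). For $x=(s_1,s_2,\ldots)\in X_C$ and $n\ge1$, let $s_0$ be the unique element of $F_0$ and let $(e_1,\ldots,e_n,d_n)\in E_{0,n}\circ F_n$ be the path corresponding to $(s_0,s_1,\ldots,s_{f_n})\in F_0\circ S_{0,f_n}$ under the unique isomorphism $F_0\circ S_{0,f_n}\cong E_{0,n}\circ F_n$; the edges $e_1,\ldots,e_n$ are consistent as $n$ varies, and $\mathcal{V}([f])(x)=(e_1,e_2,\ldots)$. *)

(* Defs.v *)
From HB Require Import structures.
From mathcomp Require Import all_boot.
From mathcomp Require Import boolp classical_sets functions.
From mathcomp Require Import topology cantor.

Set Implicit Arguments.
Unset Strict Implicit.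
Unset Printing Implicit Defensive.

Local Open Scope classical_set_scope.

Definition homeomorphism (X Y : topologicalType) (h : X -> Y) : Prop :=
  continuous h /\ exists2 k : Y -> X, continuous k & cancel h k /\ cancel k h.

Definition minimal_map (X : topologicalType) (phi : X -> X) : Prop :=
  forall A : set X, closed A -> phi @` A = A -> A = set0 \/ A = setT.

Definition cantor_minimal_system (X : topologicalType) (phi : X -> X) : Prop :=
  [/\ exists h : X -> cantor_space, homeomorphism h,
      homeomorphism phi
    & minimal_map phi].

Definition factor_map (X Y : topologicalType) (phi : X -> X) (psi : Y -> Y)
    (alpha : X -> Y) : Prop :=
  [/\ continuous alpha, set_surj setT setT alpha & alpha \o phi = psi \o alpha].

(* The order is a partial order on the whole edge set in which two edges are
   comparable iff they have the same range, i.e. a linear order on each fiber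
   of the range map. *)
Record edgeSet (S T : finType) := EdgeSet {
  edge :> finType;
  esrc : edge -> S;
  etgt : edge -> T;
  ele : rel edge;
  ele_refl : reflexive ele;
  ele_anti : antisymmetric ele;
  ele_trans : transitive ele;
  ele_comparable : forall e e', ele e e' || ele e' e = (etgt e == etgt e')
}.

Arguments esrc {S T F} : rename.
Arguments etgt {S T F} : rename.
Arguments ele {S T F} : rename.

Section EdgeOrder.
Variables (S T : finType) (F : edgeSet S T).
Implicit Types e : F.

Definition elt e e' : bool := (e != e') && ele e e'.

Definition emaximal e : bool := [forall e', ele e e' ==> (e' == e)].

Definition eminimal e : bool := [forall e', ele e' e ==> (e' == e)].

Definition esucc e e' : bool :=
  elt e e' && [forall e'', elt e e'' ==> ele e' e''].

Lemma ele_tgt e e' : ele e e' -> etgt e = etgt e'.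
Proof. by move=> le_ee'; apply/eqP; rewrite -ele_comparable le_ee'. Qed.

Lemma elt_trans e1 e2 e3 : elt e1 e2 -> elt e2 e3 -> elt e1 e3.
Proof.
move=> /andP[n12 l12] /andP[n23 l23]; rewrite /elt (ele_trans l12 l23) andbT.
apply: contraNneq n12 => e13; subst e3.
by apply/eqP/ele_anti; rewrite l12 l23.
Qed.

Lemma elt_asym e e' : elt e e' -> elt e' e = false.
Proof.
move=> /andP[nee' lee']; apply: contraNF nee' => /andP[_ le'e].
by apply/eqP/ele_anti; rewrite lee' le'e.
Qed.

Lemma ex_eminimal_in (P : pred F) e0 :
  P e0 -> exists2 e, P e & forall e', P e' -> ~~ elt e' e.
Proof.
move=> Pe0; have [e Pe ltP] := arg_minnP (fun e => #|[pred e' | elt e' e]|) Pe0.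
exists e => // e' Pe'; apply/negP => lt_e'e.
have /negP[] : ~~ (#|[pred a | elt a e]| <= #|[pred a | elt a e']|).
  rewrite -ltnNge; apply: proper_card; apply/fintype.properP; split.
    by apply/fintype.subsetP => a; rewrite !inE => /elt_trans; apply.
  by exists e'; rewrite !inE /elt ?eqxx //.
exact: ltP.
Qed.

Lemma ex_eminimal e0 : exists2 e, etgt e = etgt e0 & eminimal e.
Proof.
have [|e /eqP ee0 emin] := @ex_eminimal_in [pred e | etgt e == etgt e0] e0.
  by rewrite /= eqxx.
exists e => //; apply/forallP => e'; apply/implyP => le_e'e.
have /emin : [pred e | etgt e == etgt e0] e' by rewrite /= (ele_tgt le_e'e) ee0.
by rewrite /elt le_e'e andbT negbK.
Qed.

Lemma ex_esucc e : ~~ emaximal e -> exists e', esucc e e'.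
Proof.
move=> /forallPn[e0]; rewrite negb_imply => /andP[le0 ne0].
have [|e' lt_ee' emin] := @ex_eminimal_in [pred e' | elt e e'] e0.
  by rewrite /= /elt eq_sym ne0.
exists e'; apply/andP; split=> //; apply/forallP => e''; apply/implyP => lt_ee''.
have := emin _ lt_ee''; rewrite /elt negb_and negbK => /orP[/eqP->|].
  exact: ele_refl.
move=> /negPf nle; have := ele_comparable e' e''; rewrite nle orbF => ->.
case/andP: lt_ee' => _ /ele_tgt <-; case/andP: lt_ee'' => _ /ele_tgt <-.
exact: eqxx.
Qed.

End EdgeOrder.

Section Composition.
Variables (S T U : finType) (F : edgeSet S T) (G : edgeSet T U).

Definition comp_edge : finType := {p : F * G | etgt p.1 == esrc p.2}.

Definition comp_le : rel comp_edge := fun p q =>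
  elt (val p).2 (val q).2 ||
  ((val p).2 == (val q).2) && ele (val p).1 (val q).1.

Lemma comp_le_refl : reflexive comp_le.
Proof. by move=> p; rewrite /comp_le eqxx ele_refl orbT. Qed.

Lemma comp_le_anti : antisymmetric comp_le.
Proof.
move=> p q /andP[]; rewrite /comp_le => /orP[lt_pq|/andP[/eqP e2 le_pq]].
  rewrite (elt_asym lt_pq) /= => /andP[/eqP e2 _].
  by move: lt_pq; rewrite /elt e2 eqxx.
rewrite e2 /elt eqxx /= => le_qp; apply: val_inj.
have e1 : (val p).1 = (val q).1 by apply/ele_anti; rewrite le_pq le_qp.
by case: (val p) (val q) e1 e2 => ? ? [? ?] /= -> ->.
Qed.

Lemma comp_le_trans : transitive comp_le.
Proof.
move=> q p r; rewrite /comp_le => /orP[lt_pq|/andP[/eqP e2 le_pq]].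
  by case/orP=> [/(elt_trans lt_pq)->//|/andP[/eqP<- _]]; rewrite lt_pq.
rewrite -e2; case/orP=> [->//|/andP[-> le_qr]].
by rewrite (ele_trans le_pq le_qr) orbT.
Qed.

Lemma comp_le_comparable p q :
  comp_le p q || comp_le q p = (etgt (val p).2 == etgt (val q).2).
Proof.
rewrite -ele_comparable /comp_le /elt eq_sym.
have [e2|ne2] := eqVneq (val p).2 (val q).2; last by rewrite !orbF.
rewrite !(e2, ele_refl) /= ele_comparable.
by rewrite (eqP (valP p)) (eqP (valP q)) e2 eqxx.
Qed.

Definition comp_edgeSet : edgeSet S U :=
  @EdgeSet S U comp_edge (fun p => esrc (val p).1) (fun p => etgt (val p).2)
    comp_le comp_le_refl comp_le_anti comp_le_trans comp_le_comparable.

End Composition.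

Section TrivialEdgeSets.

Definition id_edgeSet (S : finType) : edgeSet S S.
Proof.
refine (@EdgeSet S S S id id (fun v w => v == w) _ _ _ _).
- exact: eqxx.
- by move=> v w /andP[/eqP].
- by move=> v u w /eqP->.
- by move=> v w; rewrite (eq_sym w) orbb.
Defined.

Definition empty_edgeSet (S T : finType) : edgeSet S T.
Proof.
by refine (@EdgeSet S T void (@of_void S) (@of_void T) (fun _ _ => true) _ _ _ _);
  case.
Defined.

End TrivialEdgeSets.

Definition edgeSet_iso_map (S T : finType) (F F' : edgeSet S T) (h : F -> F') :=
  [/\ bijective h,
      forall e, esrc (h e) = esrc e,
      forall e, etgt (h e) = etgt e
    & forall e e', ele (h e) (h e') = ele e e'].

Definition edgeSet_iso (S T : finType) (F F' : edgeSet S T) : Prop :=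
  exists h : F -> F', edgeSet_iso_map h.

(* [between E k l] is E_{k,l} for the chain V_0 -E_1-> V_1 -E_2-> ..., where
   [E n] is E_{n+1}.  The case 0 < k is reduced to k = 0 by dropping the first
   level of the chain; for k > l the result is an irrelevant empty edge set. *)
Fixpoint between (V : nat -> finType) (E : forall n, edgeSet (V n) (V n.+1))
    (k l : nat) {struct l} : edgeSet (V k) (V l) :=
  match k, l return edgeSet (V k) (V l) with
  | 0, 0 => id_edgeSet (V 0)
  | 0, l'.+1 => comp_edgeSet (between E 0 l') (E l')
  | k'.+1, 0 => empty_edgeSet (V k'.+1) (V 0)
  | k'.+1, l'.+1 => @between (fun n => V n.+1) (fun n => E n.+1) k' l'
  end.

(* [segment x p] : the finite path [p] from level k to level l is the part
   (x_{k+1}, ..., x_l) of the sequence of edges [x] (indexed so that [x n] is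
   x_{n+1}); if k = l, it is the trivial path at the source of x_{k+1}. *)
Fixpoint segment (V : nat -> finType) (E : forall n, edgeSet (V n) (V n.+1))
    (x : forall n, E n) (k l : nat) {struct l} : between E k l -> bool :=
  match k, l return between E k l -> bool with
  | 0, 0 => fun v => v == esrc (x 0)
  | 0, l'.+1 => fun p => segment x (val p).1 && ((val p).2 == x l')
  | k'.+1, 0 => fun _ => false
  | k'.+1, l'.+1 =>
      @segment (fun n => V n.+1) (fun n => E n.+1) (fun n => x n.+1) k' l'
  end.

(* [edges B n] is E_{n+1}. *)
Record orderedBratteli := OrderedBratteli {
  vertices : nat -> finType;
  edges : forall n, edgeSet (vertices n) (vertices n.+1);
  vertices_gt0 : forall n, 0 < #|vertices n|;
  vertices0 : #|vertices 0| = 1;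
  edges_gt0 : forall n, 0 < #|edges n|;
  esrc_onto : forall n (v : vertices n), exists e : edges n, esrc e = v;
  etgt_onto : forall n (v : vertices n.+1), exists e : edges n, etgt e = v
}.

Definition is_path (B : orderedBratteli) :
    set (prod_topology (fun n => discrete_topology (edges B n))) :=
  [set x | forall n, etgt (x n : edges B n) = esrc (x n.+1 : edges B n.+1)].

(* The topology is induced from the product of the discrete sets E_n, hence
   has the cylinder sets as a basis. *)
Definition path_space (B : orderedBratteli) : topologicalType :=
  set_type (@is_path B).

Definition path_edge (B : orderedBratteli) (x : path_space B) (n : nat) :
  edges B n := set_val x n.

Definition max_path (B : orderedBratteli) (x : path_space B) : Prop :=
  forall n, emaximal (path_edge x n).

Definition min_path (B : orderedBratteli) (x : path_space B) : Prop :=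
  forall n, eminimal (path_edge x n).

Record properBratteli := ProperBratteli {
  diagram :> orderedBratteli;
  ex1_max_path : exists! x : path_space diagram, max_path x;
  ex1_min_path : exists! x : path_space diagram, min_path x
}.

Lemma ex_xmax (B : properBratteli) : exists x : path_space B, max_path x.
Proof. by have [x []] := ex1_max_path B; exists x. Qed.

Lemma ex_xmin (B : properBratteli) : exists x : path_space B, min_path x.
Proof. by have [x []] := ex1_min_path B; exists x. Qed.

Definition xmax (B : properBratteli) : path_space B := sval (cid (ex_xmax B)).

Definition xmin (B : properBratteli) : path_space B := sval (cid (ex_xmin B)).

Definition vershik_step (B : orderedBratteli) (x y : path_space B) : Prop :=
  exists k, [/\ forall i, i < k -> emaximal (path_edge x i),
                ~~ emaximal (path_edge x k),
                forall i, i < k -> eminimal (path_edge y i),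
                esucc (path_edge x k) (path_edge y k)
              & forall i, k < i -> path_edge y i = path_edge x i].

(* The default value [x] is never used, see [vershikP]. *)
Definition vershik (B : properBratteli) (x : path_space B) : path_space B :=
  if x == xmax B then xmin B else xget x (vershik_step x).

Section VershikFacts.
Variable B : properBratteli.

Lemma xmaxP : max_path (xmax B).
Proof. exact: svalP (cid (ex_xmax B)). Qed.

Lemma xminP : min_path (xmin B).
Proof. exact: svalP (cid (ex_xmin B)). Qed.

Lemma max_path_xmax (x : path_space B) : max_path x -> x = xmax B.
Proof.
have [z [_ zuniq]] := ex1_max_path B => mx.
by rewrite -(zuniq _ mx); apply: zuniq; exact: xmaxP.
Qed.

Lemma path_edgeP (x : path_space B) n :
  etgt (path_edge x n) = esrc (path_edge x n.+1).
Proof. by have := set_valP x; apply. Qed.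

Lemma extend_eminimal k (x : forall n, edges B n) :
    (forall n, k <= n -> etgt (x n) = esrc (x n.+1)) ->
  exists2 y : path_space B, forall i, i < k -> eminimal (path_edge y i)
    & forall i, k <= i -> path_edge y i = x i.
Proof.
elim: k x => [|k IHk] x xP.
  have xB : @is_path B x by move=> n; exact: xP.
  by exists (SigSub (mem_set xB)).
have [e0 e0P] := etgt_onto (esrc (x k.+1)).
have [e ee0 emin] := ex_eminimal e0.
have neq_k n : k < n -> k != n by move=> lt_kn; rewrite neq_ltn lt_kn.
have [n|y ymin yx] := IHk (dfwith x e).
  rewrite leq_eqVlt => /predU1P[<-|lt_kn].
    by rewrite dfwith_in dfwith_out ?ee0 // neq_k.
  by rewrite !dfwith_out ?xP // neq_k // ltnS ltnW.
exists y => i.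
  rewrite ltnS leq_eqVlt => /predU1P[->|/ymin//].
  by rewrite yx // dfwith_in.
by move=> lt_ki; rewrite yx 1?ltnW // dfwith_out // neq_k.
Qed.

Lemma vershikP (x : path_space B) : x <> xmax B -> vershik_step x (vershik x).
Proof.
move=> xNmax; rewrite /vershik; case: eqP => // _.
suff [y xy] : exists y, vershik_step x y by apply: (xgetI _ xy).
have [n nP] : exists n, ~~ emaximal (path_edge x n).
  apply: contrapT => nex; apply: xNmax; apply: max_path_xmax => n.
  by apply/negPn/negP => nn; apply: nex; exists n.
have /ex_minnP[k kN kmin] : exists n, ~~ emaximal (path_edge x n) by exists n.
have [f fS] := ex_esucc kN.
have neq_k i : k < i -> k != i by move=> lt_ki; rewrite neq_ltn lt_ki.
have [i|y ymin yx] := @extend_eminimal k (dfwith (path_edge x) f).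
  rewrite leq_eqVlt => /predU1P[<-|lt_ki].
    rewrite dfwith_in dfwith_out ?neq_k // -path_edgeP.
    by case/andP: fS => /andP[_ /ele_tgt].
  by rewrite !dfwith_out ?path_edgeP // neq_k // ltnS ltnW.
exists y, k; split=> //.
- move=> i; by move=> lt_ik; apply: contraLR lt_ik => /kmin; rewrite -leqNgt.
- by rewrite yx // dfwith_in.
- by move=> i lt_ki; rewrite yx 1?ltnW // dfwith_out // neq_k.
Qed.

End VershikFacts.

Definition pointed_conjugacy (X : topologicalType) (phi : X -> X) (x0 : X)
    (B : properBratteli) (theta : X -> path_space B) : Prop :=
  [/\ homeomorphism theta,
      theta \o phi = @vershik B \o theta
    & theta x0 = xmax B].

Definition bratteli_vershik_model (X : topologicalType) (phi : X -> X) (x0 : X)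
    (B : properBratteli) : Prop :=
  exists theta : X -> path_space B, pointed_conjugacy phi x0 theta.

Record premorphism (B C : orderedBratteli) := Premorphism {
  pm_level : nat -> nat;
  pm_edges : forall n, edgeSet (vertices B n) (vertices C (pm_level n));
  pm_level0 : pm_level 0 = 0;
  pm_level_homo : forall n, pm_level n <= pm_level n.+1;
  pm_level_unbounded : forall N, exists n, N < pm_level n;
  pm_edges_gt0 : forall n, 0 < #|pm_edges n|;
  pm_esrc_onto : forall n (v : vertices B n), exists e : pm_edges n, esrc e = v;
  pm_etgt_onto : forall n (w : vertices C (pm_level n)),
    exists e : pm_edges n, etgt e = w;
  pm_edges0 : #|pm_edges 0| = 1;
  pm_comm : forall n,
    edgeSet_iso (comp_edgeSet (edges B n) (pm_edges n.+1))
      (comp_edgeSet (pm_edges n)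
        (between (edges C) (pm_level n) (pm_level n.+1)))
}.

Section Premorphisms.
Variables B C : orderedBratteli.

Definition premorphism_equiv (f g : premorphism B C) : Prop :=
  exists n m : nat -> nat, 0 < n 0 /\
  forall k,
  [/\ n k < m k < n k.+1,
      pm_level f (n k) < pm_level g (m k) < pm_level f (n k.+1),
      edgeSet_iso
        (comp_edgeSet (between (edges B) (n k) (m k)) (pm_edges g (m k)))
        (comp_edgeSet (pm_edges f (n k))
          (between (edges C) (pm_level f (n k)) (pm_level g (m k))))
    & edgeSet_iso
        (comp_edgeSet (between (edges B) (m k) (n k.+1)) (pm_edges f (n k.+1)))
        (comp_edgeSet (pm_edges g (m k))
          (between (edges C) (pm_level g (m k)) (pm_level f (n k.+1))))].

(* Classes are plain predicates: [premorphism] is too large a type for the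
   universe of [set]. *)
Definition premorphism_classes : Type :=
  {c : premorphism B C -> Prop | exists f, c = premorphism_equiv f}.

Definition premorphism_class (f : premorphism B C) : premorphism_classes :=
  exist _ (premorphism_equiv f) (ex_intro _ f erefl).

(* [y] is the path (e_1, e_2, ...) in X_B associated with x = (s_1, s_2, ...)
   in X_C.  As f_0 = 0, S_{0,f_n} is written S_{f_0,f_n}; the elements [p] of
   F_0 o S_{f_0,f_n} considered are the paths (s_0, s_1, ..., s_{f_n}). *)
Definition premorphism_path (f : premorphism B C) (x : path_space C)
    (y : path_space B) : Prop :=
  forall n, 0 < n ->
  exists2 h :
      comp_edgeSet (pm_edges f 0)
        (between (edges C) (pm_level f 0) (pm_level f n)) ->
      comp_edgeSet (between (edges B) 0 n) (pm_edges f n),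
    edgeSet_iso_map h
  & forall p, segment (path_edge x) (val p).2 ->
              segment (path_edge y) (val (h p)).1.

End Premorphisms.

(* The map V([f]), computed from the representative f.  The default value is
   irrelevant: for every x exactly one path is associated with x. *)
Definition premorphism_map (B C : properBratteli) (f : premorphism B C)
    (x : path_space C) : path_space B :=
  xget (xmax B) (premorphism_path f x).

Definition pointed_factor_map (X Y : topologicalType) (phi : X -> X) (x : X)
    (psi : Y -> Y) (y : Y) : Type :=
  {alpha : X -> Y | factor_map phi psi alpha /\ alpha x = y}.

(* Main.v *)
Require Import Defs.
From mathcomp Require Import all_boot.
From mathcomp Require Import boolp classical_sets functions.
From mathcomp Require Import topology cantor.

Set Implicit Arguments.
Unset Strict Implicit.
Unset Printing Implicit Defensive.

Local Open Scope classical_set_scope.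

(** Truncating a path after its first [n] edges sends X_B onto the finite set
E_{0,n}, and this set is itself an ordered edge set, from V_0 to V_n: its
fibers are the Kakutani-Rokhlin towers of level [n]. The truncation [stem]
carries the Vershik map into the relation [estep], which is: move to the
successor, or pass from a maximal to a minimal path. Conversely this relation,
at all levels, determines the Vershik map ([vershik_unique]).

The heart of the proof is a dictionary between ordered edge sets F from V_n to
W_l and maps [a] from the level-l towers of C to the level-n towers of B. Say
that F is a [tiling] with map [a] if there is an isomorphism S_{0,l} -> E_{0,n}
o F whose first component is [a]; it says that every tower of level l is cut,
in the way prescribed by F, into towers of level n.
- F determines [a], because isomorphisms of ordered edge sets are unique
  ([tiling_map_unique]).
- [a] determines F up to isomorphism: the edges of F correspond to the places
  where a new tower begins, i.e. to the p such that [a p] is minimal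
  ([tiling_edges_unique]).
- A map [a] is the map of some tiling as soon as it respects [estep] and sends
  minimal paths to minimal paths and maximal ones to maximal ones
  ([tile_tiling]).

A premorphism f yields a tiling F_n at every n, whose map [pm_map] sends the
stem of x at level f_n to the stem of V(f)(x) at level n. Hence V(f) is
continuous, commutes with the Vershik maps and preserves the maximal path; it
is onto because its image is closed and invariant in a minimal system. Since F
and [a] determine each other, the isomorphisms that define the equivalence of f
and g hold iff V(f) and V(g) agree on stems ([premorphism_iso_stem]), so that
f and g are equivalent iff V(f) = V(g) ([premorphism_equivP]).

Conversely let [alpha] be a factor map preserving the maximal paths. By
compactness the stem of [alpha x] at level n is a function of the stem of [x]
at every large level l. As [alpha] also preserves the minimal paths, and x_min
is the only path in all the bases of the towers, compactness again shows that
[alpha] maps the base of the towers of a large level l into the base of the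
towers of level n. Then [tile_tiling] applies and gives F_n; the relations
E_{n+1} o F_{n+1} = F_n o S hold because both sides are tilings with the same
map ([factor_premorphism]). *)

(** * Linear orders on the fibers of an edge set *)

Lemma inj_surj_bij (A B : Type) (h : A -> B) :
  injective h -> (forall b, exists a, h a = b) -> bijective h.
Proof.
move=> hI hS; pose g b := sval (cid (hS b)).
have gK : cancel g h by move=> b; exact: (svalP (cid (hS b))).
by exists g => // a; apply: hI; rewrite gK.
Qed.

Section FiberOrder.
Variables (S T : finType) (F : edgeSet S T).
Implicit Types e : F.

Lemma ele_total e e' : etgt e = etgt e' -> ele e e' || ele e' e.
Proof. by move=> eq_ee'; rewrite ele_comparable eq_ee' eqxx. Qed.

Lemma elt_irr e : elt e e = false.
Proof. by rewrite /elt eqxx. Qed.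

Lemma eltW e e' : elt e e' -> ele e e'.
Proof. by case/andP. Qed.

Lemma ele_eqVlt e e' : ele e e' = (e == e') || elt e e'.
Proof. by rewrite /elt; case: eqVneq => //= ->; rewrite ele_refl. Qed.

Lemma ele_lt_trans e1 e2 e3 : ele e1 e2 -> elt e2 e3 -> elt e1 e3.
Proof. by rewrite ele_eqVlt => /predU1P[->//|/elt_trans]; apply. Qed.

Lemma ele_ltF e e' : ele e e' -> elt e' e = false.
Proof. by move=> le_ee'; apply/negP => /(ele_lt_trans le_ee'); rewrite elt_irr. Qed.

Lemma elt_total e e' : etgt e = etgt e' -> [\/ e = e', elt e e' | elt e' e].
Proof.
move/ele_total; rewrite !ele_eqVlt [e' == e]eq_sym; case: eqVneq => /=.
  by move=> ->; constructor 1.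
by move=> _ /orP[]; [constructor 2|constructor 3].
Qed.

(** Comparability within fibers makes a minimal edge the least of its fiber. *)
Lemma eminimal_le e e' : eminimal e -> etgt e = etgt e' -> ele e e'.
Proof.
move=> /forallP/(_ e')/implyP emin /ele_total/orP[//|/[dup] le_e'e /emin /eqP->].
exact: ele_refl.
Qed.

Lemma eminimal_inj e e' : eminimal e -> eminimal e' -> etgt e = etgt e' -> e = e'.
Proof.
move=> emin e'min ee'; apply/ele_anti/andP.
by split; apply: eminimal_le.
Qed.

Lemma eminimal_ltF e e' : eminimal e' -> elt e e' = false.
Proof.
move=> /forallP/(_ e)/implyP emin; apply/negP => /[dup] /eltW/emin/eqP->.
by rewrite elt_irr.
Qed.

Lemma emaximal_ltF e e' : emaximal e -> elt e e' = false.
Proof.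
move=> /forallP/(_ e')/implyP emax; apply/negP => /[dup] /eltW/emax/eqP->.
by rewrite elt_irr.
Qed.

Lemma eminimalP e : (forall e', elt e' e = false) -> eminimal e.
Proof.
move=> emin; apply/forallP => e'; apply/implyP.
by rewrite ele_eqVlt emin orbF.
Qed.

Lemma emaximalP e : (forall e', elt e e' = false) -> emaximal e.
Proof.
move=> emax; apply/forallP => e'; apply/implyP.
by rewrite ele_eqVlt emax orbF eq_sym.
Qed.

Lemma esucc_lt e e' : esucc e e' -> elt e e'.
Proof. by case/andP. Qed.

Lemma esucc_tgt e e' : esucc e e' -> etgt e = etgt e'.
Proof. by move=> /esucc_lt/eltW/ele_tgt. Qed.

Lemma esucc_le e e' e'' : esucc e e' -> elt e e'' -> ele e' e''.
Proof. by case/andP => _ /forallP/(_ e'')/implyP. Qed.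

Lemma esucc_ge e e' e'' : esucc e e' -> elt e'' e' -> ele e'' e.
Proof.
move=> ee' lt_e''e'; have [] := @elt_total e e''.
- by rewrite (esucc_tgt ee') (ele_tgt (eltW lt_e''e')).
- by move=> ->; exact: ele_refl.
- by move/(esucc_le ee')/ele_ltF; rewrite lt_e''e'.
- exact: eltW.
Qed.

Lemma esucc_fun e e1 e2 : esucc e e1 -> esucc e e2 -> e1 = e2.
Proof.
move=> s1 s2; apply/ele_anti/andP.
by split; [apply: esucc_le s1 _|apply: esucc_le s2 _]; apply: esucc_lt.
Qed.

Lemma esuccP e e' :
  elt e e' -> (forall e'', elt e e'' -> elt e'' e' = false) -> esucc e e'.
Proof.
move=> lt_ee' bet; apply/andP; split=> //; apply/forallP => e''.
apply/implyP => lt_ee''; have [|->|//|] := @elt_total e' e''.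
- by rewrite -(ele_tgt (eltW lt_ee')) (ele_tgt (eltW lt_ee'')).
- exact: ele_refl.
- exact: eltW.
- by rewrite bet.
Qed.

(** A strict predecessor with the most edges below it is the immediate one. *)
Lemma ex_epred e : ~~ eminimal e -> exists e', esucc e' e.
Proof.
move=> /forallPn[e0]; rewrite negb_imply => /andP[le0 ne0].
have lt0 : elt e0 e by rewrite /elt eq_sym eq_sym ne0.
have [e' lt_e'e e'max] :=
  arg_maxnP (P := fun e' => elt e' e) (fun e' => #|[pred a | elt a e']|) lt0.
exists e'; apply: esuccP => // e'' lt_e'e''; apply/negP => lt_e''e.
have := e'max _ lt_e''e; rewrite /= leqNgt => /negP[].
apply: proper_card; apply/fintype.properP; split.
  by apply/fintype.subsetP => a; rewrite !inE => /elt_trans; apply.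
by exists e'; rewrite !inE ?elt_irr.
Qed.

(** A fiber is a finite chain, so it can be explored upwards from its minimal
    edge; this replaces any numbering of the edges. *)
Lemma esucc_ind (P : F -> Prop) :
    (forall e, eminimal e -> P e) ->
    (forall e e', esucc e e' -> P e -> P e') ->
  forall e, P e.
Proof.
move=> Pmin PS e; have [n] := ubnP #|[pred a | elt a e]|.
elim: n e => // n IHn e; rewrite ltnS => le_n.
have [/Pmin//|/ex_epred[e' e'e]] := boolP (eminimal e).
apply: PS (e'e) _; apply: IHn; apply: leq_trans le_n; apply: proper_card.
have lt_e'e := esucc_lt e'e; apply/fintype.properP; split.
  by apply/fintype.subsetP => a; rewrite !inE => /elt_trans; apply.
by exists e'; rewrite !inE ?elt_irr.
Qed.

(** One step of the cyclic successor, with the fibers left unspecified at the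
    passage from a maximal to a minimal edge: this is what the Vershik map
    does to the first edges of a path, at every level simultaneously. *)
Definition estep e e' : bool := esucc e e' || emaximal e && eminimal e'.

Lemma estep_nmax e e' : ~~ emaximal e -> estep e e' = esucc e e'.
Proof. by rewrite /estep => /negPf->; rewrite orbF. Qed.

Lemma estep_max e e' : emaximal e -> estep e e' = eminimal e'.
Proof.
by move=> emax; rewrite /estep emax /esucc (emaximal_ltF _ emax).
Qed.

Lemma estep_min e e' : eminimal e' -> estep e e' = emaximal e.
Proof.
by move=> emin; rewrite /estep emin /esucc (eminimal_ltF _ emin) andbT.
Qed.

End FiberOrder.

(** * Order isomorphisms over the target *)

Section OrderIso.

(** Isomorphisms over the common target; unlike in [edgeSet_iso_map], the
    sources may live in different sets. *)
Definition order_iso (S S' T : finType) (F : edgeSet S T) (F' : edgeSet S' T)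
    (h : F -> F') : Prop :=
  [/\ bijective h, forall e, etgt (h e) = etgt e
    & forall e e', ele (h e) (h e') = ele e e'].

Section Facts.
Variables (S S' T : finType) (F : edgeSet S T) (F' : edgeSet S' T).

Lemma order_iso_elt (h : F -> F') : order_iso h ->
  forall e e', elt (h e) (h e') = elt e e'.
Proof. by move=> [/bij_inj hI _ hle] e e'; rewrite /elt hle (inj_eq hI). Qed.

Lemma order_iso_inv (h : F -> F') : order_iso h ->
  exists2 k : F' -> F, order_iso k & cancel h k /\ cancel k h.
Proof.
move=> [[k hK kK] htgt hle]; exists k => //; split.
- by exists h.
- by move=> e; rewrite -htgt kK.
- by move=> e e'; rewrite -hle !kK.
Qed.

Lemma order_iso_min (h : F -> F') e :
  order_iso h -> eminimal e -> eminimal (h e).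
Proof.
move=> hiso emin; apply: eminimalP => e'; have [k _ [_ kK]] := order_iso_inv hiso.
by rewrite -(kK e') order_iso_elt // eminimal_ltF.
Qed.

Lemma order_iso_max (h : F -> F') e :
  order_iso h -> emaximal e -> emaximal (h e).
Proof.
move=> hiso emax; apply: emaximalP => e'; have [k _ [_ kK]] := order_iso_inv hiso.
by rewrite -(kK e') order_iso_elt // emaximal_ltF.
Qed.

Lemma order_iso_succ (h : F -> F') e e' :
  order_iso h -> esucc e e' -> esucc (h e) (h e').
Proof.
move=> hiso ee'; apply: esuccP => [|e'']; first by rewrite order_iso_elt ?esucc_lt.
have [k _ [_ kK]] := order_iso_inv hiso; rewrite -(kK e'') !order_iso_elt //.
by move/(esucc_le ee')/ele_ltF.
Qed.

(** Finite chains have no nontrivial automorphism. *)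
Lemma order_iso_unique (h h' : F -> F') : order_iso h -> order_iso h' -> h =1 h'.
Proof.
move=> hiso h'iso; apply: esucc_ind => [e emin|e e' ee' IHe].
  apply: eminimal_inj; rewrite ?order_iso_min //.
  by have [_ -> _] := hiso; have [_ -> _] := h'iso.
apply: (@esucc_fun _ _ _ (h e)); first exact: order_iso_succ.
by rewrite IHe; apply: order_iso_succ.
Qed.

(** Since fibers are totally ordered, strict monotonicity suffices. *)
Lemma mono_order_iso (h : F -> F') : (forall e, etgt (h e) = etgt e) ->
    (forall e e', elt e e' -> elt (h e) (h e')) ->
    (forall e', exists e, h e = e') ->
  order_iso h.
Proof.
move=> htgt hlt hsurj; have hle e e' : ele (h e) (h e') = ele e e'.
  apply/idP/idP => [le_h|]; last first.
    by rewrite ele_eqVlt => /predU1P[->|/hlt/eltW//]; rewrite ele_refl.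
  have [|->|/eltW//|/hlt] := @elt_total _ _ _ e e'.
  - by rewrite -!htgt (ele_tgt le_h).
  - exact: ele_refl.
  - by rewrite ele_ltF.
split=> //; apply: inj_surj_bij => // e e' hee'; apply/ele_anti.
by rewrite -!hle hee' ele_refl.
Qed.

End Facts.

Lemma order_iso_id (S T : finType) (F : edgeSet S T) : @order_iso S S T F F id.
Proof. by split=> //; exists id. Qed.

Lemma order_iso_comp (S1 S2 S3 T : finType) (F1 : edgeSet S1 T)
    (F2 : edgeSet S2 T) (F3 : edgeSet S3 T) (h : F1 -> F2) (k : F2 -> F3) :
  order_iso h -> order_iso k -> order_iso (k \o h).
Proof.
move=> [hb ht hl] [kb kt kl]; split=> [|e|e e'] /=.
- exact: bij_comp.
- by rewrite kt ht.
- by rewrite kl hl.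
Qed.

Section EdgeSetIso.
Variables (S T : finType).
Implicit Types F : edgeSet S T.

Lemma edgeSet_iso_mapE F F' (h : F -> F') :
  edgeSet_iso_map h <-> order_iso h /\ forall e, esrc (h e) = esrc e.
Proof. by split=> [[]|[[]]]. Qed.

Lemma edgeSet_iso_refl F : edgeSet_iso F F.
Proof. by exists id; split=> //; exists id. Qed.

Lemma edgeSet_iso_sym F F' : edgeSet_iso F F' -> edgeSet_iso F' F.
Proof.
move=> [h /edgeSet_iso_mapE[/order_iso_inv[k kiso [hK kK]] hsrc]].
by exists k; apply/edgeSet_iso_mapE; split=> // e; rewrite -hsrc kK.
Qed.

Lemma edgeSet_iso_trans F F' F'' :
  edgeSet_iso F F' -> edgeSet_iso F' F'' -> edgeSet_iso F F''.
Proof.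
move=> [h /edgeSet_iso_mapE[hiso hsrc]] [k /edgeSet_iso_mapE[kiso ksrc]].
exists (k \o h); apply/edgeSet_iso_mapE; split; first exact: order_iso_comp.
by move=> e /=; rewrite ksrc.
Qed.

End EdgeSetIso.

End OrderIso.

(** * The order of a composition *)

Section CompositionFacts.
Variables (S T U : finType) (F : edgeSet S T) (G : edgeSet T U).
Implicit Types p q : comp_edgeSet F G.

Definition cpair (e : F) (g : G) (eg : etgt e = esrc g) : comp_edgeSet F G :=
  exist _ (e, g) (introT eqP eg).

Lemma comp_match p : etgt (val p).1 = esrc (val p).2.
Proof. exact/eqP/(valP p). Qed.

Lemma comp_inj p q : (val p).1 = (val q).1 -> (val p).2 = (val q).2 -> p = q.
Proof.
move=> e1 e2; apply: val_inj.
by case: (val p) (val q) e1 e2 => ? ? [? ?] /= -> ->.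
Qed.

Lemma comp_eqE p q :
  (p == q) = ((val p).1 == (val q).1) && ((val p).2 == (val q).2).
Proof.
apply/eqP/andP => [->|[/eqP e1 /eqP e2]]; first by rewrite !eqxx.
exact: comp_inj.
Qed.

Lemma comp_ele p q : ele p q =
  elt (val p).2 (val q).2 ||
  ((val p).2 == (val q).2) && ele (val p).1 (val q).1.
Proof. by []. Qed.

Lemma comp_elt p q : elt p q =
  elt (val p).2 (val q).2 ||
  ((val p).2 == (val q).2) && elt (val p).1 (val q).1.
Proof.
rewrite {1}/elt comp_ele; have [->|npq] := eqVneq p q.
  by rewrite !elt_irr andbF.
have [e2|//] := eqVneq (val p).2 (val q).2; rewrite e2 elt_irr /= ele_eqVlt.
case: eqVneq => //= e1; case/negP: npq; apply/eqP; exact: comp_inj.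
Qed.

Lemma comp_eminimal p :
  eminimal (val p).1 -> eminimal (val p).2 -> eminimal p.
Proof.
move=> min1 min2; apply: eminimalP => q.
by rewrite comp_elt !eminimal_ltF // andbF.
Qed.

Lemma comp_emaximal p :
  emaximal (val p).1 -> emaximal (val p).2 -> emaximal p.
Proof.
move=> max1 max2; apply: emaximalP => q.
by rewrite comp_elt !emaximal_ltF // andbF.
Qed.

Lemma comp_eminimal1 p : eminimal p -> eminimal (val p).1.
Proof.
move=> pmin; apply: eminimalP => e; apply/negP => lt_ep.
pose q := cpair (etrans (ele_tgt (eltW lt_ep)) (comp_match p)).
by have := eminimal_ltF q pmin; rewrite comp_elt /= eqxx lt_ep orbT.
Qed.

Lemma comp_emaximal1 p : emaximal p -> emaximal (val p).1.
Proof.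
move=> pmax; apply: emaximalP => e; apply/negP => lt_pe.
pose q := cpair (etrans (esym (ele_tgt (eltW lt_pe))) (comp_match p)).
by have := emaximal_ltF q pmax; rewrite comp_elt /= eqxx lt_pe orbT.
Qed.

(** When a composite edge moves to its successor, its first component either
    moves to its successor or runs out and restarts. *)
Lemma comp_estep1 p q : estep p q -> estep (val p).1 (val q).1.
Proof.
case/orP => [pq|/andP[pmax qmin]]; last first.
  by rewrite /estep comp_emaximal1 ?comp_eminimal1 ?orbT.
have := esucc_lt pq; rewrite comp_elt => /orP[lt2|/andP[/eqP e2 lt1]]; last first.
  apply/orP; left; apply: esuccP => // e lt_pe; apply/negP => lt_eq.
  pose r := cpair (etrans (ele_tgt (eltW lt_eq)) (comp_match q)).
  have lt_pr : elt p r by rewrite comp_elt /= e2 eqxx lt_pe orbT.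
  have := esucc_le pq lt_pr; rewrite comp_ele /= eqxx elt_irr /=.
  by move/ele_ltF; rewrite lt_eq.
apply/orP; right; apply/andP; split.
  apply: emaximalP => e; apply/negP => lt_pe.
  pose r := cpair (etrans (esym (ele_tgt (eltW lt_pe))) (comp_match p)).
  have lt_pr : elt p r by rewrite comp_elt /= eqxx lt_pe orbT.
  have lt_rq : elt r q by rewrite comp_elt /= lt2.
  by have := ele_ltF (esucc_le pq lt_pr); rewrite lt_rq.
apply: eminimalP => e; apply/negP => lt_eq.
pose r := cpair (etrans (ele_tgt (eltW lt_eq)) (comp_match q)).
have lt_pr : elt p r by rewrite comp_elt /= lt2.
have lt_rq : elt r q by rewrite comp_elt /= eqxx lt_eq orbT.
by have := ele_ltF (esucc_le pq lt_pr); rewrite lt_rq.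
Qed.

End CompositionFacts.

(** * Composition up to isomorphism *)

Section CompositionIso.

(** Here fibers of [F] must be nonempty: an edge of [G] below the second
    component witnesses nonminimality only if it extends to a composite edge. *)
Lemma comp_eminimal2 (S T U : finType) (F : edgeSet S T) (G : edgeSet T U)
    (p : comp_edgeSet F G) : (forall t, exists e : F, etgt e = t) ->
  eminimal p -> eminimal (val p).2.
Proof.
move=> Fonto pmin; apply: eminimalP => g; apply/negP => lt_gp.
have [e eg] := Fonto (esrc g).
by have := eminimal_ltF (cpair eg) pmin; rewrite comp_elt /= lt_gp.
Qed.

Lemma comp_emaximal2 (S T U : finType) (F : edgeSet S T) (G : edgeSet T U)
    (p : comp_edgeSet F G) : (forall t, exists e : F, etgt e = t) ->
  emaximal p -> emaximal (val p).2.
Proof.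
move=> Fonto pmax; apply: emaximalP => g; apply/negP => lt_pg.
have [e eg] := Fonto (esrc g).
by have := emaximal_ltF (cpair eg) pmax; rewrite comp_elt /= lt_pg.
Qed.

(** The isomorphisms of composites below all come with the value of their
    first component, since it is this component that a tiling records. *)
Lemma comp_iso_l (S S' T U : finType) (F : edgeSet S T) (F' : edgeSet S' T)
    (G : edgeSet T U) (h : F -> F') : order_iso h ->
  exists2 k : comp_edgeSet F G -> comp_edgeSet F' G, order_iso k
    & forall p, (val (k p)).1 = h (val p).1.
Proof.
move=> hiso; have [h' [_ h'tgt _] [hK h'K]] := order_iso_inv hiso.
have [_ htgt _] := hiso.
exists (fun p => cpair (etrans (htgt (val p).1) (comp_match p))) => //.
apply: mono_order_iso => // [p q|q].
  by rewrite !comp_elt /= order_iso_elt.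
exists (cpair (etrans (h'tgt (val q).1) (comp_match q))).
by apply: comp_inj => //=; rewrite h'K.
Qed.

Lemma comp_iso_r (S T U : finType) (F : edgeSet S T) (G G' : edgeSet T U) :
    edgeSet_iso G G' ->
  exists2 k : comp_edgeSet F G -> comp_edgeSet F G', order_iso k
    & forall p, (val (k p)).1 = (val p).1.
Proof.
move=> [h /edgeSet_iso_mapE[hiso hsrc]].
have [h' _ [hK h'K]] := order_iso_inv hiso.
have h'src e : esrc (h' e) = esrc e by rewrite -hsrc h'K.
have [_ htgt _] := hiso.
exists (fun p => cpair (etrans (comp_match p) (esym (hsrc (val p).2)))) => //.
apply: mono_order_iso => [p|p q|q] /=.
- exact: htgt.
- by rewrite !comp_elt /= order_iso_elt // (can_eq hK).
exists (cpair (etrans (comp_match q) (esym (h'src (val q).2)))).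
by apply: comp_inj => //=; rewrite h'K.
Qed.

Lemma comp_assoc (S T U W : finType) (F : edgeSet S T) (G : edgeSet T U)
    (H : edgeSet U W) :
  exists2 k : comp_edgeSet (comp_edgeSet F G) H ->
              comp_edgeSet F (comp_edgeSet G H), order_iso k
    & forall p, (val (k p)).1 = (val (val p).1).1.
Proof.
pose k (p : comp_edgeSet (comp_edgeSet F G) H) :
    comp_edgeSet F (comp_edgeSet G H) :=
  @cpair _ _ _ F (comp_edgeSet G H) (val (val p).1).1
    (@cpair _ _ _ G H (val (val p).1).2 (val p).2 (comp_match p))
    (comp_match (val p).1).
exists k => //; apply: mono_order_iso => // [p q|q].
  rewrite /k !comp_elt /= comp_eqE /= andb_orr orbA.
  by rewrite [(_ == _) && ((val p).2 == _)]andbC andbA.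
pose r := @cpair _ _ _ F G (val q).1 (val (val q).2).1 (comp_match q).
exists (@cpair _ _ _ (comp_edgeSet F G) H r (val (val q).2).2
  (comp_match (val q).2)).
by apply: comp_inj => //; apply: comp_inj.
Qed.

Lemma comp_unit (S T : finType) (F : edgeSet S T) :
  exists2 k : F -> comp_edgeSet F (id_edgeSet T), order_iso k
    & forall p, (val (k p)).1 = p.
Proof.
exists (fun e => @cpair _ _ _ F (id_edgeSet T) e (etgt e) erefl) => //.
apply: mono_order_iso => // [e e' lt_ee'|q].
  by rewrite comp_elt /= lt_ee' (ele_tgt (eltW lt_ee')) eqxx orbT.
by exists (val q).1; apply: comp_inj => //; exact: (comp_match q).
Qed.

End CompositionIso.

(** * Tilings of towers by towers *)

Section Tiling.

(** In the application [S] and [E] are the edge sets of finite paths from the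
    top vertices of [C] and [B] to levels [l] and [n], and [a p] is the level-n
    path at which a point in position [p] sits. *)
Definition tiling (U U' V W : finType) (S : edgeSet U W) (E : edgeSet U' V)
    (F : edgeSet V W) (a : S -> E) : Prop :=
  exists2 h : S -> comp_edgeSet E F, order_iso h
    & forall p, (val (h p)).1 = a p.

Section Facts.
Variables (U U' V W : finType) (S : edgeSet U W) (E : edgeSet U' V).
Implicit Types (F : edgeSet V W) (a : S -> E).

Lemma tiling_map_unique F a a' : tiling F a -> tiling F a' -> a =1 a'.
Proof.
move=> [h hiso ha] [h' h'iso h'a] p.
by rewrite -ha -h'a (order_iso_unique hiso h'iso).
Qed.

Lemma tiling_eq F a a' : a =1 a' -> tiling F a -> tiling F a'.
Proof. by move=> aa' [h hiso ha]; exists h => // p; rewrite ha aa'. Qed.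

Lemma tiling_iso F F' a : edgeSet_iso F F' -> tiling F a -> tiling F' a.
Proof.
move=> /(@comp_iso_r _ _ _ E)[k kiso k1] [h hiso ha].
exists (k \o h); first exact: order_iso_comp.
by move=> p /=; rewrite k1 ha.
Qed.

Lemma tiling_estep F a p q : tiling F a -> estep p q -> estep (a p) (a q).
Proof.
move=> [h hiso ha] pq; rewrite -!ha; apply: comp_estep1.
case/orP: pq => [pq|/andP[pmax qmin]]; apply/orP.
  by left; apply: order_iso_succ.
by right; rewrite order_iso_max ?order_iso_min.
Qed.

Lemma tiling_min F a p : tiling F a -> eminimal p -> eminimal (a p).
Proof.
by move=> [h hiso ha] pmin; rewrite -ha; apply/comp_eminimal1/order_iso_min.
Qed.

Lemma tiling_max F a p : tiling F a -> emaximal p -> emaximal (a p).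
Proof.
by move=> [h hiso ha] pmax; rewrite -ha; apply/comp_emaximal1/order_iso_max.
Qed.

(** The towers of a deeper level, [S1], are first cut into towers of [S]. *)
Lemma tiling_compr F a (U1 W1 : finType) (S1 : edgeSet U1 W1) (G : edgeSet W W1)
    (j : S1 -> comp_edgeSet S G) : order_iso j -> tiling F a ->
  tiling (comp_edgeSet F G) (fun p => a (val (j p)).1).
Proof.
move=> jiso [h hiso ha]; have [k kiso k1] := comp_iso_l G hiso.
have [c ciso c1] := comp_assoc E F G.
exists (c \o (k \o j)); first by do 2![apply: order_iso_comp => //].
by move=> p /=; rewrite c1 k1 ha.
Qed.

(** The towers of [E] are cut further into the smaller towers of [E1]. *)
Lemma tiling_compl F a (V1 U1 : finType) (E1 : edgeSet U1 V1) (G : edgeSet V1 V)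
    (j : E -> comp_edgeSet E1 G) : order_iso j -> tiling F a ->
  tiling (comp_edgeSet G F) (fun p => (val (j (a p))).1).
Proof.
move=> jiso [h hiso ha]; have [k kiso k1] := comp_iso_l F jiso.
have [c ciso c1] := comp_assoc E1 G F.
exists (c \o (k \o h)); first by do 2![apply: order_iso_comp => //].
by move=> p /=; rewrite c1 k1 ha.
Qed.

(** A tiling by two successive edge sets refines the map to the intermediate
    level; this is how the maps of a premorphism are built inductively. *)
Lemma tiling_lift (V1 : finType) (G : edgeSet V V1) (F : edgeSet V1 W) a :
    tiling (comp_edgeSet G F) a ->
  exists a' : S -> comp_edgeSet E G, tiling F a'.
Proof.
move=> [h hiso _]; have [c ciso _] := comp_assoc E G F.
have [c' c'iso _] := order_iso_inv ciso.
exists (fun p => (val (c' (h p))).1), (c' \o h) => //.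
exact: order_iso_comp.
Qed.

Section Canonical.
Variable a : S -> E.

(** A tile begins wherever [a] takes a minimal value, so it is named by the
    place where it begins. *)
Definition tile_edge : finType := {p : S | eminimal (a p)}.

Definition tile_le : rel tile_edge := fun p q => ele (val p) (val q).

Lemma tile_le_refl : reflexive tile_le.
Proof. by move=> p; exact: ele_refl. Qed.

Lemma tile_le_anti : antisymmetric tile_le.
Proof. by move=> p q /ele_anti/val_inj. Qed.

Lemma tile_le_trans : transitive tile_le.
Proof. by move=> p q r; exact: ele_trans. Qed.

Lemma tile_le_comparable p q :
  tile_le p q || tile_le q p = (etgt (val p) == etgt (val q)).
Proof. exact: ele_comparable. Qed.

Definition tile_edgeSet : edgeSet V W :=
  @EdgeSet V W tile_edge (fun p => etgt (a (val p))) (fun p => etgt (val p))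
    tile_le tile_le_refl tile_le_anti tile_le_trans tile_le_comparable.

Lemma tile_elt (r r' : tile_edgeSet) : elt r r' = elt (val r) (val r').
Proof. by rewrite /elt -(inj_eq val_inj). Qed.

Lemma tile_min (r : tile_edgeSet) : eminimal (a (val r)).
Proof. exact: (valP r). Qed.

Definition tile_at p (pmin : eminimal (a p)) : tile_edgeSet :=
  exist (fun p => is_true (eminimal (a p))) p pmin.

(** The tile containing [p] is the last one that begins at or before [p]. *)
Lemma tile_exists :
    (forall p, eminimal p -> eminimal (a p)) ->
    (forall p q, esucc p q -> estep (a p) (a q)) ->
  forall p, exists z : comp_edgeSet E tile_edgeSet, [/\ (val z).1 = a p,
    ele (val (val z).2) p
  & forall r : tile_edgeSet, ele (val r) p -> ele r (val z).2].
Proof.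
move=> amin astep; apply: esucc_ind => [p pmin|p q pq [z [z1 z2 zmax]]].
  exists (@cpair _ _ _ E tile_edgeSet (a p) (tile_at (amin p pmin)) erefl).
  by split=> //=; rewrite ele_refl.
case/orP: (astep _ _ pq) => [a_pq|/andP[_ qmin]].
  have m : etgt (a q) = esrc (val z).2 by rewrite -(esucc_tgt a_pq) -z1 comp_match.
  exists (cpair m); split=> //=.
    by apply: ele_trans z2 _; apply/eltW/esucc_lt.
  move=> r; rewrite ele_eqVlt => /predU1P[rq|lt_rq].
    by have := esucc_lt a_pq; rewrite -rq (eminimal_ltF _ (tile_min r)).
  exact/zmax/(esucc_ge pq).
exists (@cpair _ _ _ E tile_edgeSet (a q) (tile_at qmin) erefl).
by split=> //=; rewrite ele_refl.
Qed.

(** Moving up in a tower of [S], the values of [a] climb a tower of [E]; when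
    they reach its top they restart at the bottom of another one, where a new
    tile begins. The conditions on minimal and maximal edges ensure that the
    first tile begins at the bottom and that the last one is complete. *)
Lemma tile_tiling :
    (forall p, eminimal p -> eminimal (a p)) ->
    (forall p, emaximal p -> emaximal (a p)) ->
    (forall p q, esucc p q -> estep (a p) (a q)) ->
  tiling tile_edgeSet a.
Proof.
move=> amin amax astep.
have [h hP] := choice (tile_exists amin astep).
have ha p : (val (h p)).1 = a p by have [] := hP p.
have h2le p : ele (val (val (h p)).2) p by have [] := hP p.
have h2max p (r : tile_edgeSet) : ele (val r) p -> ele r (val (h p)).2.
  by have [_ _] := hP p; apply.
have h2min p (pmin : eminimal (a p)) : val (val (h p)).2 = p.
  apply/ele_anti/andP; split=> //.
  exact: (h2max p (tile_at pmin) (ele_refl _)).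
(* A step of [a] within a tower of [E] does not change the tile. *)
have h2const p q : esucc p q -> esucc (a p) (a q) -> (val (h q)).2 = (val (h p)).2.
  move=> pq apq; apply/ele_anti/andP; split; last first.
    by apply: h2max; apply: ele_trans (h2le p) _; apply/eltW/esucc_lt.
  apply: h2max; have := h2le q; rewrite ele_eqVlt => /predU1P[eq_q|lt_q].
    have := esucc_lt apq.
    by rewrite -{1}eq_q (eminimal_ltF _ (tile_min (val (h q)).2)).
  exact: esucc_ge pq lt_q.
have hS p q : esucc p q -> elt (h p) (h q).
  move=> pq; rewrite comp_elt !ha.
  case/orP: (astep _ _ pq) => [apq|/andP[_ qmin]].
    by rewrite (h2const _ _ pq apq) eqxx (esucc_lt apq) orbT.
  rewrite tile_elt (h2min q qmin); apply/orP; left.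
  exact: ele_lt_trans (h2le p) (esucc_lt pq).
exists h => //; apply: mono_order_iso => [p|p q|].
- by rewrite -[RHS](ele_tgt (h2le p)).
- move: q p; apply: esucc_ind => [q qmin p|q q' qq' IHq p lt_pq'].
    by rewrite eminimal_ltF.
  have := esucc_ge qq' lt_pq'; rewrite ele_eqVlt => /predU1P[->|lt_pq].
    exact: hS.
  exact: elt_trans (IHq _ lt_pq) (hS _ _ qq').
(* Every position [e] of the tile [r] is reached: start at the bottom of [r]
   and climb; a tower of [S] cannot end inside a tile, by [amax]. *)
suff surj e (r : tile_edgeSet) : etgt e = esrc r ->
    exists p, (val (h p)).1 = e /\ (val (h p)).2 = r.
  by move=> z; have [p [z1 z2]] := surj _ _ (comp_match z); exists p; apply: comp_inj.
move: e; apply: esucc_ind => [e emin er|e e' ee' IHe e'r].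
  exists (val r); rewrite ha; split; first exact/esym/eminimal_inj/er/(tile_min r).
  by apply: val_inj; rewrite h2min //; exact: tile_min.
have [|p [p1 p2]] := IHe; first by rewrite (esucc_tgt ee').
have pNmax : ~~ emaximal (a p).
  by rewrite -ha p1; apply/negP => /(emaximal_ltF e'); rewrite esucc_lt.
have [q pq] : exists q, esucc p q by apply: ex_esucc; apply: contra pNmax => /amax.
have := astep _ _ pq; rewrite estep_nmax // => apq; exists q.
rewrite (h2const _ _ pq apq) p2 ha; split=> //; apply: (esucc_fun _ ee').
by rewrite -p1 ha.
Qed.

(** An edge [f] of a tiling is recovered from the place where its tile begins:
    the composite of [f] with the minimal edge at its source. *)
Lemma tiling_tile_iso F : (forall v, exists e : E, etgt e = v) -> tiling F a ->
  edgeSet_iso tile_edgeSet F.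
Proof.
move=> Eonto [h hiso ha]; have [_ htgt _] := hiso.
exists (fun r : tile_edgeSet => (val (h (val r))).2); apply/edgeSet_iso_mapE.
split; last by move=> r; rewrite -comp_match ha.
apply: mono_order_iso => [r|r r'|f].
- exact: (htgt (val r)).
- rewrite tile_elt -(order_iso_elt hiso) comp_elt !ha.
  by rewrite (eminimal_ltF _ (tile_min r')) andbF orbF.
have [e0 e0f] := Eonto (esrc f); have [e ee0 emin] := ex_eminimal e0.
have [k _ [_ kK]] := order_iso_inv hiso; pose p := k (cpair (etrans ee0 e0f)).
have pmin : eminimal (a p) by rewrite -ha kK.
by exists (tile_at pmin) => /=; rewrite kK.
Qed.

End Canonical.

(** Both edge sets are isomorphic to the canonical one, which depends on [a]
    only. *)
Lemma tiling_edges_unique F F' a : (forall v, exists e : E, etgt e = v) ->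
  tiling F a -> tiling F' a -> edgeSet_iso F F'.
Proof.
move=> Eonto /(tiling_tile_iso Eonto)/edgeSet_iso_sym aF /(tiling_tile_iso Eonto).
exact: edgeSet_iso_trans.
Qed.

End Facts.

End Tiling.

(** * Finite paths *)

Section Between.

Lemma between_nn (V : nat -> finType) (E : forall n, edgeSet (V n) (V n.+1)) n :
  edgeSet_iso (id_edgeSet (V n)) (between E n n).
Proof.
elim: n V E => [|n IHn] V E; first exact: edgeSet_iso_refl.
exact: (IHn (fun n => V n.+1) (fun n => E n.+1)).
Qed.

Lemma between_recr (V : nat -> finType) (E : forall n, edgeSet (V n) (V n.+1))
    k l : k <= l ->
  edgeSet_iso (comp_edgeSet (between E k l) (E l)) (between E k l.+1).
Proof.
elim: k l V E => [|k IHk] l V E; first by move=> _; exact: edgeSet_iso_refl.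
case: l => // l le_kl.
exact: (IHk l (fun n => V n.+1) (fun n => E n.+1)).
Qed.

(** The values of [z] below level [n] are arbitrary: only its tail is a path. *)
Lemma ex_forward_edges (V : nat -> finType)
    (E : forall n, edgeSet (V n) (V n.+1)) :
    (forall n (v : V n), exists e : E n, esrc e = v) ->
    (forall n, 0 < #|E n|) ->
  forall n (v : V n), exists z : forall m, E m,
    esrc (z n) = v /\ forall m, n <= m -> etgt (z m) = esrc (z m.+1).
Proof.
(* Induction on [n] for all chains, dropping the first level. *)
move=> out E_gt0 n; elim: n V E out E_gt0 => [|n IHn] V E out E_gt0 v.
  have [s sP] : exists s : forall m, V m -> E m, forall m w, esrc (s m w) = w.
    by exists (fun m w => sval (cid (out m w))) => m w; case: cid.
  pose fix u m : V m := if m is m'.+1 then etgt (s m' (u m')) else v.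
  by exists (fun m => s m (u m)); split=> *; rewrite !sP.
have [z [zv zP]] := IHn (fun n => V n.+1) (fun n => E n.+1)
  (fun n => out n.+1) (fun n => E_gt0 n.+1) v.
have /card_gt0P[e0 _] := E_gt0 0.
exists (fun m => if m is m'.+1 then z m' else e0); split=> // -[|m] //.
exact: zP.
Qed.

Variables (V : nat -> finType) (E : forall n, edgeSet (V n) (V n.+1)).

(** The splitting E_{0,m} = E_{0,l} o E_{l,m}; the first component is the
    truncation of the path. *)
Lemma between_split l m : l <= m ->
  exists2 j : between E 0 m -> comp_edgeSet (between E 0 l) (between E l m),
    order_iso j
  & forall (x : forall n, E n) p, segment x p -> segment x (val (j p)).1.
Proof.
elim: m => [|m IHm].
  rewrite leqn0 => /eqP->; have [j jiso j1] := comp_unit (between E 0 0).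
  have [k kiso k1] := comp_iso_r (between E 0 0) (between_nn E 0).
  exists (k \o j); first exact: order_iso_comp.
  by move=> x p; rewrite -{1}(j1 p) -k1.
rewrite leq_eqVlt => /predU1P[->|].
  have [j jiso j1] := comp_unit (between E 0 m.+1).
  have [k kiso k1] := comp_iso_r (between E 0 m.+1) (between_nn E m.+1).
  exists (k \o j); first exact: order_iso_comp.
  by move=> x p; rewrite -{1}(j1 p) -k1.
rewrite ltnS => le_lm; have [j jiso jseg] := IHm le_lm.
have [c ciso c1] := comp_iso_l (E m) jiso.
have [d diso d1] := comp_assoc (between E 0 l) (between E l m) (E m).
have [k kiso k1] := comp_iso_r (between E 0 l) (between_recr E le_lm).
exists (k \o (d \o c)); first by do 2![apply: order_iso_comp => //].
by move=> x p /= /andP[/jseg xp _]; rewrite k1 d1 c1.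
Qed.

End Between.

(** * Truncation of infinite paths *)

Section Stem.
Variable B : orderedBratteli.
Local Notation E := (edges B).
Local Notation tower := (between (edges B) 0).
Implicit Types x y z : path_space B.

Lemma tower_onto n (v : vertices B n) : exists p : tower n, etgt p = v.
Proof.
case: n v => [|n] v; first by exists v.
elim: n v => [|n IHn] v; have [e ev] := etgt_onto v.
  by exists (@cpair _ _ _ (tower 0) _ (esrc e) e erefl).
have [p pe] := IHn (esrc e).
by exists (@cpair _ _ _ (tower n.+1) _ p e pe).
Qed.

Lemma tower0_eq (p q : tower 0) : p = q.
Proof.
have /fintype_le1P le1 : #|vertices B 0| <= 1 by rewrite vertices0.
exact: (le1 q p).
Qed.

Lemma segment_unique (x : forall n, E n) n (p q : tower n) :
  segment x p -> segment x q -> p = q.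
Proof.
elim: n p q => [|n IHn] p q; first by move=> _ _; exact: tower0_eq.
move=> /= /andP[xp1 /eqP xp2] /andP[xq1 /eqP xq2].
by apply: comp_inj; [exact: IHn|rewrite xp2].
Qed.

Lemma path_edge_match x n : etgt (path_edge x n) = esrc (path_edge x n.+1).
Proof. by have := set_valP x; apply. Qed.

Lemma ex_stem x n :
  exists p : tower n, segment (path_edge x) p /\ etgt p = esrc (path_edge x n).
Proof.
elim: n => [|n [p [xp px]]]; first by exists (esrc (path_edge x 0)); rewrite /= eqxx.
exists (@cpair _ _ _ (tower n) _ p (path_edge x n) px) => /=.
by rewrite xp eqxx path_edge_match.
Qed.

Definition stem x n : tower n := sval (cid (ex_stem x n)).

Lemma stem_segment x n : segment (path_edge x) (stem x n).
Proof. by have [] := svalP (cid (ex_stem x n)). Qed.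

Lemma segmentE x n (p : tower n) :
  segment (path_edge x) p = (p == stem x n).
Proof.
apply/idP/eqP => [xp|->]; last exact: stem_segment.
exact: segment_unique xp (stem_segment x n).
Qed.

Lemma stemS1 x n : (val (stem x n.+1)).1 = stem x n.
Proof. by apply/eqP; rewrite -segmentE; have /andP[] := stem_segment x n.+1. Qed.

Lemma stemS2 x n : (val (stem x n.+1)).2 = path_edge x n.
Proof. by have /andP[_ /eqP] := stem_segment x n.+1. Qed.

(** Properties of finite paths inherited by their truncations descend along
    the stems of a path. *)
Lemma stem_mono (P : forall n, tower n -> Prop) x n m :
    (forall i (p : tower i.+1), P i.+1 p -> P i (val p).1) ->
  n <= m -> P m (stem x m) -> P n (stem x n).
Proof.
move=> PS; elim: m => [|m IHm]; first by rewrite leqn0 => /eqP->.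
by rewrite leq_eqVlt => /predU1P[->//|/IHm{}IHm /PS]; rewrite stemS1.
Qed.

Lemma stem_eqS x y n : stem x n.+1 = stem y n.+1 -> stem x n = stem y n.
Proof. by rewrite -(stemS1 x n) -(stemS1 y n) => ->. Qed.

Lemma stem_eq_le x y n m : n <= m ->
  stem x m = stem y m -> stem x n = stem y n.
Proof.
elim: m => [|m IHm]; first by rewrite leqn0 => /eqP->.
by rewrite leq_eqVlt => /predU1P[->//|/IHm{}IHm /stem_eqS].
Qed.

Lemma path_ext x y : (forall n, path_edge x n = path_edge y n) -> x = y.
Proof.
move=> xy; apply: val_inj; apply: functional_extensionality_dep => n.
exact: xy.
Qed.

Lemma stem_ext x y : (forall N, exists2 n, N <= n & stem x n = stem y n) ->
  x = y.
Proof.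
move=> xy; apply: path_ext => n; have [m lt_nm] := xy n.+1.
by move/(stem_eq_le lt_nm); rewrite -!stemS2 => ->.
Qed.

Lemma path_of_stemes (P : forall n, tower n) :
    (forall n, (val (P n.+1)).1 = P n) ->
  exists x, forall n, stem x n = P n.
Proof.
move=> PS; pose e n := (val (P n.+1)).2.
have eP : @is_path B e.
  by move=> n; rewrite /e -(comp_match (P n.+2)) PS.
exists (SigSub (mem_set eP)) => n; apply/esym/eqP; rewrite -segmentE.
elim: n => [|n IHn] /=; first by apply/eqP/tower0_eq.
by rewrite PS IHn /=; apply/eqP.
Qed.

Lemma stem_extend n (p : tower n) (z : forall m, E m) :
    etgt p = esrc (z n) -> (forall m, n <= m -> etgt (z m) = esrc (z m.+1)) ->
  exists x, stem x n = p /\ forall m, n <= m -> path_edge x m = z m.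
Proof.
elim: n p z => [|n IHn] p z pz zP.
  have zB : @is_path B z by move=> m; exact: zP.
  by exists (SigSub (mem_set zB)); split=> //; exact: tower0_eq.
have neq_n m : n < m -> n != m by move=> lt_nm; rewrite neq_ltn lt_nm.
have [|m|x [xp xz]] := IHn (val p).1 (dfwith z (val p).2).
- by rewrite dfwith_in comp_match.
- rewrite leq_eqVlt => /predU1P[<-|lt_nm].
    by rewrite dfwith_in dfwith_out ?neq_n.
  by rewrite !dfwith_out ?zP // neq_n // ltnS ltnW.
exists x; split=> [|m lt_nm]; last by rewrite xz 1?ltnW // dfwith_out // neq_n.
apply: comp_inj; first by rewrite stemS1.
by rewrite stemS2 xz // dfwith_in.
Qed.

Lemma stem_onto n (p : tower n) : exists x, stem x n = p.
Proof.
have [z [zp zP]] := ex_forward_edges (@esrc_onto B) (@edges_gt0 B) (etgt p).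
by have [x [xp _]] := stem_extend (esym zp) zP; exists x.
Qed.

Lemma min_pathP x : min_path x <-> forall n, eminimal (stem x n).
Proof.
split=> [xmin n|xmin n]; last first.
  by rewrite -stemS2; apply: comp_eminimal2 (xmin n.+1); exact: tower_onto.
elim: n => [|n IHn].
  by apply: eminimalP => p; rewrite (tower0_eq p (stem x 0)) elt_irr.
by apply: comp_eminimal; rewrite ?stemS1 // stemS2.
Qed.

Lemma max_pathP x : max_path x <-> forall n, emaximal (stem x n).
Proof.
split=> [xmax n|xmax n]; last first.
  by rewrite -stemS2; apply: comp_emaximal2 (xmax n.+1); exact: tower_onto.
elim: n => [|n IHn].
  by apply: emaximalP => p; rewrite (tower0_eq p (stem x 0)) elt_irr.
by apply: comp_emaximal; rewrite ?stemS1 // stemS2.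
Qed.

Lemma stem_min_le x n m :
  n <= m -> eminimal (stem x m) -> eminimal (stem x n).
Proof.
apply: (stem_mono (P := fun n (p : tower n) => eminimal p)) => i p.
exact: comp_eminimal1.
Qed.

Lemma stem_max_le x n m :
  n <= m -> emaximal (stem x m) -> emaximal (stem x n).
Proof.
apply: (stem_mono (P := fun n (p : tower n) => emaximal p)) => i p.
exact: comp_emaximal1.
Qed.

End Stem.

Arguments stem {B}.

(** * The Vershik map on truncated paths *)

Section VershikStem.
Variable B : properBratteli.
Implicit Types x y : path_space B.

Lemma stem_xmax n : emaximal (stem (xmax B) n).
Proof. by move: n; apply/max_pathP/xmaxP. Qed.

Lemma stem_xmin n : eminimal (stem (xmin B) n).
Proof. by move: n; apply/min_pathP/xminP. Qed.

Lemma min_path_xmin x : min_path x -> x = xmin B.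
Proof.
have [z [_ zuniq]] := ex1_min_path B => mx.
by rewrite -(zuniq _ mx); apply: zuniq; exact: xminP.
Qed.

Lemma vershik_xmax : vershik (xmax B) = xmin B.
Proof. by rewrite /vershik eqxx. Qed.

(** Let [k] be the level of the first nonmaximal edge of [x]. Up to level [k]
    the stem of [x] is maximal and its image minimal; beyond, the image is the
    successor, since the later edges do not change. *)
Lemma vershik_estep x n : estep (stem x n) (stem (vershik x) n).
Proof.
have [->|/eqP/vershikP[k [xmax _ vmin xk xtail]]] := eqVneq x (xmax B).
  by rewrite vershik_xmax estep_max ?stem_xmax ?stem_xmin.
have max_min m : m <= k ->
    emaximal (stem x m) && eminimal (stem (vershik x) m).
  elim: m => [_|m IHm lt_mk].
    apply/andP; split; [apply: emaximalP|apply: eminimalP] => p.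
      by rewrite (tower0_eq p (stem x 0)) elt_irr.
    by rewrite (tower0_eq p (stem (vershik x) 0)) elt_irr.
  have /andP[pmax pmin] := IHm (ltnW lt_mk).
  apply/andP; split; [apply: comp_emaximal|apply: comp_eminimal];
    rewrite ?stemS1 ?stemS2 //; [exact: xmax|exact: vmin].
have [/max_min|lt_kn] := leqP n k; first by rewrite /estep orbC => ->.
apply/orP; left; elim: n lt_kn => // n IHn; rewrite ltnS leq_eqVlt.
case/predU1P => [kn|lt_kn].
  move: xk; rewrite kn => xk.
  have /andP[pmax pmin] : emaximal (stem x n) && eminimal (stem (vershik x) n).
    by apply: max_min; rewrite kn.
  apply: esuccP => [|p].
    by rewrite comp_elt !stemS2 (esucc_lt xk).
  rewrite !comp_elt !stemS1 !stemS2 (emaximal_ltF _ pmax) (eminimal_ltF _ pmin).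
  by rewrite !andbF !orbF => /(esucc_le xk)/ele_ltF.
have {}IHn := IHn lt_kn; apply: esuccP => [|p].
  by rewrite comp_elt !stemS1 !stemS2 xtail // eqxx (esucc_lt IHn) orbT.
rewrite !comp_elt !stemS1 !stemS2 xtail //.
case/orP=> [lt_p|/andP[/eqP<- /(esucc_le IHn)/ele_ltF->]].
  rewrite (ele_ltF (eltW lt_p)); apply/negbTE; rewrite negb_and.
  by apply/orP; left; apply: contraTneq lt_p => ->; rewrite elt_irr.
by rewrite elt_irr andbF.
Qed.

(** If some stem of [x] is not maximal, then neither are the longer ones, whose
    images are their successors; otherwise [x] is the maximal path and all
    stems of [y] are minimal. *)
Lemma vershik_unique x y : (forall n, estep (stem x n) (stem y n)) ->
  y = vershik x.
Proof.
move=> xy; have [xmax|/existsNP[N /negP NNmax]] :=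
  pselect (forall n, emaximal (stem x n)).
  have -> : x = Defs.xmax B by apply/max_path_xmax/max_pathP.
  rewrite vershik_xmax; apply/min_path_xmin/min_pathP => n.
  by rewrite -(estep_max _ (xmax n)).
apply: stem_ext => M; exists (maxn M N); first exact: leq_maxl.
have nmax : ~~ emaximal (stem x (maxn M N)).
  by apply: contra NNmax; apply: stem_max_le; exact: leq_maxr.
by apply: (@esucc_fun _ _ _ (stem x (maxn M N)));
  rewrite -(estep_nmax _ nmax) // vershik_estep.
Qed.

End VershikStem.

(** * The topology of the path space *)

Section Cylinders.
Variable B : orderedBratteli.
Implicit Types x y : path_space B.

Lemma path_edge_nbhs x n : nbhs x [set y | path_edge y n = path_edge x n].
Proof.
have cvg_val : {for x, continuous (set_val : path_space B -> _)}.
  exact: initial_continuous.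
have := @proj_continuous nat (fun n => discrete_topology (edges B n)) n (set_val x).
move=> cvg_proj.
have : nbhs (set_val x n : discrete_topology (edges B n)) [set path_edge x n].
  exact: discrete_set1.
by move/(continuous_comp cvg_val cvg_proj).
Qed.

Lemma cylinder_nbhs x n : nbhs x [set y | stem y n = stem x n].
Proof.
elim: n => [|n IHn]; first by apply: filterE => y; exact: tower0_eq.
apply: filterS (filterI IHn (path_edge_nbhs x n)) => y [yx1 yx2] /=.
by apply: comp_inj; rewrite ?stemS1 ?stemS2.
Qed.

(** The cylinders around [x] generate a filter; it converges to [x] because it
    does so in every coordinate. *)
Lemma cylinder_sub x (A : set (path_space B)) : nbhs x A ->
  exists n, forall y, stem y n = stem x n -> A y.
Proof.
pose F : set_system (prod_topology (fun n => discrete_topology (edges B n))) :=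
  [set C | exists n, forall y, stem y n = stem x n -> C (set_val y)].
have FF : Filter F.
  split=> [|C D [n nC] [m mD]|C D CD [n nC]]; first by exists 0.
    exists (maxn n m) => y yx; split.
      by apply/nC/(stem_eq_le _ yx); exact: leq_maxl.
    by apply/mD/(stem_eq_le _ yx); exact: leq_maxr.
  by exists n => y /nC/CD.
have Fx : F --> set_val x.
  apply/cvg_sup => i C /= [_ [[D Dop <-] Dx] DC].
  exists i.+1 => y yx; apply: DC => /=.
  suff e : set_val y i = set_val x i by rewrite /= /mathcomp_extra.proj e.
  change (path_edge y i = path_edge x i).
  by rewrite -!stemS2 yx.
move=> [_ [[C Cop <-] Cx] CA].
have [n nC] : F C by apply: Fx; apply: open_nbhs_nbhs.
by exists n => y /nC/CA.
Qed.

End Cylinders.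

(** * The tilings of a premorphism *)

Section PremorphismMap.
Variables B C : orderedBratteli.
Local Notation towerB := (between (edges B) 0).
Local Notation towerC := (between (edges C) 0).

Section Tilings.
Variables (n l : nat) (F : edgeSet (vertices B n) (vertices C l)).
Variable a : towerC l -> towerB n.
Hypothesis Fa : tiling F a.

Lemma tiling_refine m : l <= m ->
  exists2 a' : towerC m -> towerB n,
    tiling (comp_edgeSet F (between (edges C) l m)) a'
  & forall x : path_space C, a' (stem x m) = a (stem x l).
Proof.
move=> le_lm; have [j jiso jseg] := between_split (edges C) le_lm.
exists (fun p => a (val (j p)).1); first exact: tiling_compr.
move=> x; have := jseg _ _ (stem_segment x m).
by rewrite segmentE => /eqP->.
Qed.

Lemma tiling_coarsen k : k <= n ->
  exists2 a' : towerC l -> towerB k,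
    tiling (comp_edgeSet (between (edges B) k n) F) a'
  & forall p (y : path_space B), a p = stem y n -> a' p = stem y k.
Proof.
move=> le_kn; have [j jiso jseg] := between_split (edges B) le_kn.
exists (fun p => (val (j (a p))).1); first exact: tiling_compl.
move=> p y ->; have := jseg _ _ (stem_segment y n).
by rewrite segmentE => /eqP->.
Qed.

End Tilings.

Section SingletonEdge.
Variables (k : nat) (F : edgeSet (vertices B 0) (vertices C k)).
Hypotheses (k0 : k = 0) (F1 : #|F| = 1).

(** The base of the induction: level [0] has a single finite path. The level
    [k] is a variable because f_0 is equal to 0 only by a hypothesis. *)
Lemma singleton_tiling : exists a : towerC k -> towerB 0, tiling F a.
Proof.
move: F F1; rewrite k0 => F' /fintype1[e eP].
have tgt_e (w : towerC 0) : etgt e = w by exact: tower0_eq.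
exists (fun=> esrc e), (fun=> @cpair _ _ _ (towerB 0) F' (esrc e) e erefl) => //.
apply: mono_order_iso => [w|w w'|z].
- exact: tgt_e.
- by rewrite (tower0_eq w w') elt_irr.
by exists (etgt e); apply: comp_inj; [exact: tower0_eq|rewrite eP].
Qed.

Lemma singleton_comp_iso l :
  exists2 j : towerC l -> comp_edgeSet F (between (edges C) k l), order_iso j
    & forall (x : forall n, edges C n) p, segment x (val (j p)).2 = segment x p.
Proof.
move: F F1; rewrite k0 => F' /fintype1[e eP].
have src_p (p : towerC l) : etgt e = esrc p by exact: (@tower0_eq C).
exists (fun p => cpair (src_p p)) => //.
apply: mono_order_iso => // [p q|z].
  by rewrite comp_elt /= => ->.
by exists (val z).2; apply: comp_inj => //=; rewrite eP.
Qed.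

End SingletonEdge.

Section Map.
Variable f : premorphism B C.
Local Notation lev := (pm_level f).

Lemma pm_tiling n :
  exists a : towerC (lev n) -> towerB n, tiling (pm_edges f n) a.
Proof.
elim: n => [|n [a Fa]].
  exact: singleton_tiling (pm_level0 f) (pm_edges0 f).
have [a' Fa' _] := tiling_refine Fa (pm_level_homo f n).
exact: tiling_lift (tiling_iso (edgeSet_iso_sym (pm_comm f n)) Fa').
Qed.

Definition pm_map n : towerC (lev n) -> towerB n := sval (cid (pm_tiling n)).

Lemma pm_mapP n : tiling (pm_edges f n) (@pm_map n).
Proof. exact: svalP (cid (pm_tiling n)). Qed.

(** Both sides are maps of a tiling, by the two isomorphic composites in the
    commutation relation of [f]. *)
Lemma pm_map_stemS x n :
  (val (pm_map (stem x (lev n.+1)))).1 = pm_map (stem x (lev n)).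
Proof.
have [a Fa a_x] := tiling_refine (@pm_mapP n) (pm_level_homo f n).
rewrite -a_x; move: (stem x _); apply: tiling_map_unique Fa.
apply: tiling_iso (pm_comm f n) _.
apply: (tiling_compl (E := towerB n.+1) (G := edges B n) (j := id)).
  exact: order_iso_id.
exact: pm_mapP.
Qed.

(** Removing the singleton F_0 from F_0 o S_{0,f_n} turns the isomorphisms that
    define V(f) into the tilings of [f]. *)
Lemma premorphism_pathP x y : premorphism_path f x y <->
  forall n, stem y n = pm_map (stem x (lev n)).
Proof.
split=> xy n; last move=> n_gt0.
  case: n => [|n]; first exact: tower0_eq.
  have [h /edgeSet_iso_mapE[hiso _] hxy] := xy n.+1 isT.
  have [j jiso jseg] :=
    singleton_comp_iso (pm_level0 f) (pm_edges0 f) (lev n.+1).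
  have {}/hxy : segment (path_edge x) (val (j (stem x (lev n.+1)))).2.
    by rewrite jseg stem_segment.
  rewrite segmentE => /eqP <-; move: (stem x _).
  apply: tiling_map_unique (@pm_mapP n.+1).
  by exists (h \o j) => //; exact: order_iso_comp.
have [j jiso jseg] := singleton_comp_iso (pm_level0 f) (pm_edges0 f) (lev n).
have [j' j'iso [jK j'K]] := order_iso_inv jiso.
have [k kiso ka] := @pm_mapP n.
exists (k \o j').
  apply/edgeSet_iso_mapE; split=> [|e]; first exact: order_iso_comp.
  exact: (@tower0_eq B).
move=> p; rewrite -{1}[p]j'K jseg !segmentE ka => /eqP->.
by rewrite xy.
Qed.

End Map.

End PremorphismMap.

(** * The factor map of a premorphism, and equivalence *)

Section PremorphismFactor.
Variables B C : properBratteli.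
Implicit Types (f g : premorphism B C) (x : path_space C).

Lemma stem_premorphism_map f x n :
  stem (premorphism_map f x) n = pm_map (stem x (pm_level f n)).
Proof.
have [y xy] := path_of_stemes (fun n => pm_map_stemS f x n).
have /(xgetI (xmax B)) : premorphism_path f x y by apply/premorphism_pathP.
by move/premorphism_pathP.
Qed.

Lemma premorphism_map_continuous f : continuous (premorphism_map f).
Proof.
move=> x A /cylinder_sub[n nA].
apply: filterS (cylinder_nbhs x (pm_level f n)) => x' x'x.
by apply: nA; rewrite !stem_premorphism_map x'x.
Qed.

Lemma premorphism_map_vershik f x :
  premorphism_map f (vershik x) = vershik (premorphism_map f x).
Proof.
apply: vershik_unique => n; rewrite !stem_premorphism_map.
exact: tiling_estep (pm_mapP f n) (vershik_estep x _).
Qed.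

Lemma premorphism_map_xmax f : premorphism_map f (xmax C) = xmax B.
Proof.
apply/max_path_xmax/max_pathP => n; rewrite stem_premorphism_map.
exact: tiling_max (pm_mapP f n) (stem_xmax _ _).
Qed.

Section Compare.
Variables (f g : premorphism B C) (n m : nat).
Hypotheses (le_nm : n <= m) (le_fg : pm_level f n <= pm_level g m).

(** The two composites are edge sets of tilings, with maps sending the stem of
    [x] at level g_m to the stems of V(g)(x) and V(f)(x) at level [n]; and
    edge sets of tilings are isomorphic iff their maps are equal. *)
Lemma premorphism_iso_stem :
  edgeSet_iso
    (comp_edgeSet (between (edges B) n m) (pm_edges g m))
    (comp_edgeSet (pm_edges f n)
       (between (edges C) (pm_level f n) (pm_level g m))) <->
  forall x, stem (premorphism_map f x) n = stem (premorphism_map g x) n.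
Proof.
have [a Fa ax] := tiling_refine (pm_mapP f n) le_fg.
have [b Gb bx] := tiling_coarsen (pm_mapP g m) le_nm.
have {}ax x : a (stem x (pm_level g m)) = stem (premorphism_map f x) n.
  by rewrite ax stem_premorphism_map.
have {}bx x : b (stem x (pm_level g m)) = stem (premorphism_map g x) n.
  by apply: bx; rewrite stem_premorphism_map.
split=> [GF x|fg]; first by rewrite -ax -bx (tiling_map_unique (tiling_iso GF Gb) Fa).
apply: tiling_edges_unique Gb _; first exact: tower_onto.
apply: tiling_eq Fa => p; have [x <-] := stem_onto p.
by rewrite ax bx.
Qed.

End Compare.

Lemma pm_level_far f N M : exists n, N < n /\ M < pm_level f n.
Proof.
have le_f i j : i <= j -> pm_level f i <= pm_level f j.
  by apply: (homo_leq leqnn leq_trans); exact: pm_level_homo.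
have [n lt_n] := pm_level_unbounded f (maxn M (pm_level f N)).
exists n; split; last exact: leq_ltn_trans (leq_maxl _ _) lt_n.
rewrite ltnNge; apply/negP => /le_f; rewrite leqNgt.
by rewrite (leq_ltn_trans (leq_maxr _ _) lt_n).
Qed.

Lemma premorphism_equivP f g :
  premorphism_equiv f g <-> premorphism_map f = premorphism_map g.
Proof.
split=> [[n [m [n0 nm]]]|fg].
  apply: functional_extensionality_dep => x; apply: stem_ext => N.
  have le_n k : k <= n k.
    elim: k => // k IHk; have [/andP[lt1 lt2] _ _ _] := nm k.
    exact: leq_ltn_trans IHk (ltn_trans lt1 lt2).
  exists (n N) => //; have [/andP[lt_nm _] /andP[lt_fg _] fg _] := nm N.
  exact: (premorphism_iso_stem (ltnW lt_nm) (ltnW lt_fg)).1 fg x.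
(* Any sufficiently fast interlaced choice of levels works. *)
have [s sP] := choice (fun n => pm_level_far g n (pm_level f n)).
have [t tP] := choice (fun m => pm_level_far f m (pm_level g m)).
pose n k := iter k (t \o s) 1; exists n, (s \o n); split=> // k /=.
have [lt_s lt_gs] := sP (n k); have [lt_t lt_ft] := tP (s (n k)).
split; [by rewrite lt_s|by rewrite lt_gs| |].
  by apply/premorphism_iso_stem; rewrite ?fg // ltnW.
by apply/premorphism_iso_stem; rewrite ?fg // ltnW.
Qed.

End PremorphismFactor.

(** * The premorphism of a factor map *)

(** Dini's argument: an increasing sequence of open sets that covers a compact
    space is eventually the whole space. *)
Lemma compact_eventually (T : topologicalType) (P : nat -> T -> Prop) :
    compact [set: T] ->
    (forall l x, P l x -> nbhs x (P l)) ->
    (forall l x, P l x -> P l.+1 x) ->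
    (forall x, exists l, P l x) ->
  exists N, forall l, N <= l -> forall x, P l x.
Proof.
move=> Tco Popen PS Pex; have Ple l m x : l <= m -> P l x -> P m x.
  elim: m => [|m IHm]; first by rewrite leqn0 => /eqP->.
  by rewrite leq_eqVlt => /predU1P[->//|/IHm{}IHm /IHm]; exact: PS.
apply: contrapT => nex.
have ex_bad l : exists x, ~ P l x.
  apply: contrapT => nbad; apply: nex; exists l => m le_lm x.
  by apply: (Ple _ _ _ le_lm); apply: contrapT => nP; apply: nbad; exists x.
pose F := filter_from [set: nat] (fun l => [set x | ~ P l x]).
have FF : ProperFilter F.
  apply: filter_from_proper; last by move=> l _; exact: ex_bad.
  apply: filter_from_filter => [|l m _ _]; first by exists 0.
  exists (maxn l m) => // x nP.
  by split=> Px; apply: nP; apply: Ple Px; rewrite ?leq_maxl ?leq_maxr.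
have [x [_ xF]] := Tco F FF filterT; have [l Plx] := Pex x.
have Fl : F [set y | ~ P l y] by exists l.
by have [y [nPy Py]] := xF _ _ Fl (Popen _ _ Plx).
Qed.

Section FactorPremorphism.
Variables (B C : properBratteli) (alpha : path_space C -> path_space B).
Hypothesis C_compact : compact [set: path_space C].
Hypothesis alpha_continuous : continuous alpha.
Hypothesis alpha_surj : forall y, exists x, alpha x = y.
Hypothesis alpha_vershik : forall x, alpha (vershik x) = vershik (alpha x).
Hypothesis alpha_xmax : alpha (xmax C) = xmax B.
Local Notation towerB := (between (edges B) 0).
Local Notation towerC := (between (edges C) 0).
Implicit Types x : path_space C.

(** Level [l] of [C] resolves level [n] of [B] if the towers of level [l] are
    fine enough to be tiled by towers of level [n] along [alpha]. *)
Definition resolves n l : Prop :=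
  (forall x x', stem x' l = stem x l ->
     stem (alpha x') n = stem (alpha x) n) /\
  (forall x, eminimal (stem x l) -> eminimal (stem (alpha x) n)).

Lemma resolves0 l : resolves 0 l.
Proof.
split=> [x x' _|x _]; first exact: tower0_eq.
by rewrite (tower0_eq (stem (alpha x) 0) (stem (xmin B) 0)) stem_xmin.
Qed.

Lemma alpha_xmin : alpha (xmin C) = xmin B.
Proof. by rewrite -vershik_xmax alpha_vershik alpha_xmax vershik_xmax. Qed.

Lemma alpha_nbhs x n : nbhs x [set x' | stem (alpha x') n = stem (alpha x) n].
Proof. exact: alpha_continuous (cylinder_nbhs (alpha x) n). Qed.

(** Compactness, first with the continuity of [alpha], then with the fact that
    x_min, which [alpha] preserves, is the only path with all stems minimal. *)
Lemma resolves_eventually n : exists N, forall l, N <= l -> resolves n l.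
Proof.
have [l x|l x|x|N1 det] := @compact_eventually _ (fun l x => forall x',
    stem x' l = stem x l -> stem (alpha x') n = stem (alpha x) n) C_compact.
- move=> Px; apply: filterS (cylinder_nbhs x l) => x1 x1x x2 x2x1.
  by rewrite (Px x1) // Px // x2x1.
- by move=> Px x' /stem_eqS/Px.
- have [l lP] := cylinder_sub (alpha_nbhs x n).
  by exists l.
have [l x|l x|x|N2 min] := @compact_eventually _ (fun l x =>
    eminimal (stem x l) -> eminimal (stem (alpha x) n)) C_compact.
- move=> Px; apply: filterS (filterI (cylinder_nbhs x l) (alpha_nbhs x n)).
  by move=> x' [-> ->].
- by move=> Px /(stem_min_le (leqnSn l))/Px.
- have [xmin|/existsNP[l nmin]] := pselect (forall l, eminimal (stem x l)).
    exists 0; have -> : x = Defs.xmin C by apply/min_path_xmin/min_pathP.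
    by move=> _; rewrite alpha_xmin stem_xmin.
  by exists l.
exists (maxn N1 N2) => l; rewrite geq_max => /andP[le1 le2].
by split=> [x x'|x]; [exact: det|exact: min].
Qed.

(** Maximal stems need no separate requirement: one step further lies a
    minimal stem, and only a maximal path can precede a minimal one. *)
Lemma resolves_tiling n l : resolves n l ->
  exists2 a : towerC l -> towerB n, tiling (tile_edgeSet a) a
    & forall x, a (stem x l) = stem (alpha x) n.
Proof.
move=> [det min].
pose a (p : towerC l) := stem (alpha (sval (cid (stem_onto p)))) n.
have ax x : a (stem x l) = stem (alpha x) n.
  by apply: det; exact: svalP (cid (stem_onto _)).
exists a => //; apply: tile_tiling => [p|p|p q].
- by have [x <-] := stem_onto p; rewrite ax; exact: min.
- have [x <-] := stem_onto p => pmax; rewrite ax.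
  have := vershik_estep (alpha x) n; rewrite -alpha_vershik estep_min //.
  by apply: min; rewrite -(estep_max _ pmax); exact: vershik_estep.
have [x <-] := stem_onto p => pq.
have pNmax : ~~ emaximal (stem x l).
  by apply/negP => /(emaximal_ltF q); rewrite esucc_lt.
have := vershik_estep x l; rewrite estep_nmax // => /(esucc_fun pq)->.
by rewrite !ax alpha_vershik; exact: vershik_estep.
Qed.

Lemma factor_premorphism :
  exists f : premorphism B C, forall x, premorphism_map f x = alpha x.
Proof.
have [N NP] := choice resolves_eventually.
(* The value 0 at 0 is imposed, and harmless since every level resolves
   level 0. *)
pose fix lev n := if n is n'.+1 then (lev n' + N n).+1 else 0.
have lev_homo n : lev n <= lev n.+1 by rewrite /= leqW // leq_addr.
have lev_gt M : M < lev M.+1.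
  by elim: M => // M IHM; exact: (leq_trans IHM (leq_addr (N M.+2) _)).
have lev_resolves n : resolves n (lev n).
  by case: n => [|n]; [exact: resolves0|apply: NP; rewrite /= leqW // leq_addl].
have a_ex n : exists2 a : towerC (lev n) -> towerB n, tiling (tile_edgeSet a) a
    & forall x, a (stem x (lev n)) = stem (alpha x) n.
  exact: resolves_tiling (lev_resolves n).
pose a n := sval (cid2 (a_ex n)); pose F n := tile_edgeSet (a n).
have Fa n : tiling (F n) (a n) by rewrite /F /a; case: cid2.
have ax n x : a n (stem x (lev n)) = stem (alpha x) n by rewrite /a; case: cid2.
have F_tgt n (w : vertices C (lev n)) : exists e : F n, etgt e = w.
  have [p0 p0w] := tower_onto w; have [p pp0 pmin] := ex_eminimal p0.
  by exists (tile_at (tiling_min (Fa n) pmin)); rewrite -p0w -pp0.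
have F_src n (v : vertices B n) : exists e : F n, esrc e = v.
  have [q0 q0v] := tower_onto v; have [q qq0 qmin] := ex_eminimal q0.
  have [y yq] := stem_onto q; have [x xy] := alpha_surj y.
  have pmin : eminimal (a n (stem x (lev n))) by rewrite ax xy yq.
  by exists (tile_at pmin); rewrite /= ax xy yq qq0.
have F_gt0 n : 0 < #|F n|.
  have /card_gt0P[w _] := vertices_gt0 C (lev n).
  by have [e _] := F_tgt n w; apply/card_gt0P; exists e.
have F01 : #|F 0| = 1.
  apply/eqP; rewrite eqn_leq F_gt0 andbT; apply/fintype_le1P => r r'.
  by apply: val_inj; exact: (@tower0_eq C).
have F_comm n : edgeSet_iso (comp_edgeSet (edges B n) (F n.+1))
    (comp_edgeSet (F n) (between (edges C) (lev n) (lev n.+1))).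
  have [b Fb bx] := tiling_refine (Fa n) (lev_homo n).
  have Fc : tiling (comp_edgeSet (edges B n) (F n.+1))
      (fun p => (val (a n.+1 p)).1).
    apply: (tiling_compl (E := towerB n.+1) (G := edges B n) (j := id)) (Fa n.+1).
    exact: order_iso_id.
  apply: tiling_edges_unique Fc _; first exact: tower_onto.
  apply: tiling_eq Fb => p; have [x <-] := stem_onto p.
  by rewrite bx !ax stemS1.
have lev_unbounded M : exists n, M < lev n by exists M.+1.
pose f := @Premorphism B C lev F erefl lev_homo lev_unbounded F_gt0 F_src F_tgt
  F01 F_comm.
exists f => x; apply: stem_ext => M; exists M => //.
rewrite stem_premorphism_map -ax; move: (stem x _).
exact: tiling_map_unique (pm_mapP f M) (Fa M).
Qed.

End FactorPremorphism.

(** * Transport along the pointed conjugacies *)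

Section Transport.
Variables (X Y : topologicalType) (h : X -> Y).
Hypothesis h_homeo : homeomorphism h.

Lemma homeomorphism_compact : compact [set: Y] -> compact [set: X].
Proof.
have [_ [k kc [hK _]]] := h_homeo => Yco.
have -> : [set: X] = k @` [set: Y].
  by apply/seteqP; split=> // x _; exists (h x).
by apply: continuous_compact => //; exact: continuous_subspaceT.
Qed.

Lemma homeomorphism_hausdorff : hausdorff_space Y -> hausdorff_space X.
Proof.
have [hc [k _ [hK _]]] := h_homeo => Yh p q pq.
apply: (can_inj hK); apply: Yh => U V pU qV.
by have [x [Ux Vx]] := pq _ _ (hc _ _ pU) (hc _ _ qV); exists (h x).
Qed.

Lemma homeomorphism_inv :
  exists2 k : Y -> X, homeomorphism k & cancel h k /\ cancel k h.
Proof.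
have [hc [k kc [hK kK]]] := h_homeo; exists k => //.
by split=> //; exists h.
Qed.

End Transport.

(** The image is closed by compactness and invariant because [phi] is onto. *)
Lemma minimal_factor_surj (X Y : topologicalType) (phi : X -> X) (psi : Y -> Y)
    (alpha : X -> Y) :
    compact [set: X] -> hausdorff_space Y -> minimal_map psi ->
    (forall x, exists x', phi x' = x) -> [set: X] !=set0 ->
    continuous alpha -> alpha \o phi = psi \o alpha ->
  set_surj setT setT alpha.
Proof.
move=> Xco Yh Ymin phi_surj [x0 _] alpha_c alpha_phi.
have comm x : alpha (phi x) = psi (alpha x) by have := congr1 (@^~ x) alpha_phi.
have [||im0|imT] := Ymin (alpha @` [set: X]).
- apply: compact_closed => //; apply: continuous_compact => //.
  exact: continuous_subspaceT.
- apply/seteqP; split=> [_ [_ [x _ <-] <-]|_ [x _ <-]].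
    by exists (phi x); rewrite ?comm.
  have [x' <-] := phi_surj x; exists (alpha x'); first by exists x'.
  by rewrite comm.
- have : (alpha @` [set: X]) (alpha x0) by exists x0.
  by rewrite im0.
by move=> y _; have : (alpha @` [set: X]) y by rewrite imT.
Qed.

Theorem proposition4p6 (X Y : topologicalType) (phi : X -> X) (psi : Y -> Y)
    (x : X) (y : Y) (C B : properBratteli)
    (hX : cantor_minimal_system phi) (hY : cantor_minimal_system psi)
    (hC : bratteli_vershik_model phi x C)
    (hB : bratteli_vershik_model psi y B) :
  ((exists alpha : X -> Y, factor_map phi psi alpha /\ alpha x = y) <->
   (exists f : premorphism B C, True))
  /\
  (forall (thetaX : X -> path_space C) (thetaY : Y -> path_space B),
     pointed_conjugacy phi x thetaX -> pointed_conjugacy psi y thetaY ->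
     exists Phi : premorphism_classes B C -> pointed_factor_map phi x psi y,
       bijective Phi /\
       forall f : premorphism B C,
         thetaY \o sval (Phi (premorphism_class f)) =
         premorphism_map f \o thetaX).
Proof.
suff main (thetaX : X -> path_space C) (thetaY : Y -> path_space B) :
    pointed_conjugacy phi x thetaX -> pointed_conjugacy psi y thetaY ->
    exists Phi : premorphism_classes B C -> pointed_factor_map phi x psi y,
      bijective Phi /\
      forall f : premorphism B C,
        thetaY \o sval (Phi (premorphism_class f)) =
        premorphism_map f \o thetaX.
  split=> //; have [thetaX XC] := hC; have [thetaY YB] := hB.
  have [Phi [[Psi _ PhiK] _]] := main _ _ XC YB; split=> [[alpha alphaP]|[f _]].
    have [c [f _]] := Psi (exist _ alpha alphaP).
    by exists f.
  by have [alpha alphaP] := Phi (premorphism_class f); exists alpha.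
move=> [thX thX_phi thX_x] [thY thY_psi thY_y].
have [[hX' hX'_homeo] phi_homeo _] := hX.
have [[hY' hY'_homeo] _ psi_min] := hY.
have X_compact := homeomorphism_compact hX'_homeo cantor_space_compact.
have Y_hausdorff := homeomorphism_hausdorff hY'_homeo cantor_space_hausdorff.
have [etaX etaX_homeo [thXK etaXK]] := homeomorphism_inv thX.
have [etaY [etaYc _] [thYK etaYK]] := homeomorphism_inv thY.
have [[thXc _] [thYc _] [etaXc _]] := And3 thX thY etaX_homeo.
have C_compact := homeomorphism_compact etaX_homeo X_compact.
have thX_phiE a : thetaX (phi a) = vershik (thetaX a) := congr1 (@^~ a) thX_phi.
have thY_psiE b : thetaY (psi b) = vershik (thetaY b) := congr1 (@^~ b) thY_psi.
have phi_surj a : exists a', phi a' = a.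
  by have [_ [k _ [_ kK]]] := phi_homeo; exists (k a).
pose pull (f : premorphism B C) a := etaY (premorphism_map f (thetaX a)).
have pullP f : factor_map phi psi (pull f) /\ pull f x = y.
  have pull_c : continuous (pull f).
    move=> a; apply: (@continuous_comp _ _ _ thetaX (etaY \o premorphism_map f)).
      exact: thXc.
    apply: continuous_comp; first exact: premorphism_map_continuous.
    exact: etaYc.
  have pull_phi : pull f \o phi = psi \o pull f.
    apply: functional_extensionality_dep => a; apply: (can_inj thYK).
    by rewrite /= /pull thX_phiE thY_psiE !etaYK premorphism_map_vershik.
  split; last by rewrite /pull thX_x premorphism_map_xmax -thY_y thYK.
  split=> //; apply: minimal_factor_surj pull_phi => //.
  by exists x.
pose Phi (c : premorphism_classes B C) : pointed_factor_map phi x psi y :=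
  exist _ (pull (sval (cid (svalP c)))) (pullP _).
(* The representative chosen in a class has the same map as [f]. *)
have PhiE f : sval (Phi (premorphism_class f)) = pull f.
  rewrite /Phi /=; case: cid => g /= fg.
  apply: functional_extensionality_dep => a.
  rewrite /pull; suff /premorphism_equivP-> : premorphism_equiv f g by [].
  by rewrite fg; apply/premorphism_equivP.
exists Phi; split=> [|f]; last first.
  rewrite PhiE; apply: functional_extensionality_dep => a.
  by rewrite /= /pull etaYK.
have classP (c : premorphism_classes B C) : exists f, c = premorphism_class f.
  case: c => c [f cf]; exists f; rewrite /premorphism_class.
  by subst c; congr exist; exact: Prop_irrelevance.
apply: inj_surj_bij => [c c'|[alpha [[alpha_c alpha_surj alpha_phi] alpha_x]]].
  have [f ->] := classP c; have [g ->] := classP c'.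
  move=> /(congr1 sval); rewrite !PhiE => fg.
  have {}fg : premorphism_map f = premorphism_map g.
    apply: functional_extensionality_dep => a; rewrite -(etaXK a).
    exact: (can_inj etaYK (congr1 (@^~ (etaX a)) fg)).
  suff efg : premorphism_equiv f = premorphism_equiv g.
    rewrite /premorphism_class; move: (ex_intro _ f _) (ex_intro _ g _).
    by rewrite efg => pf pg; congr exist; exact: Prop_irrelevance.
  apply: functional_extensionality_dep => k; apply: propext.
  by split=> /premorphism_equivP fk; apply/premorphism_equivP; congruence.
have alphaE a : alpha (phi a) = psi (alpha a) := congr1 (@^~ a) alpha_phi.
have [||||f fP] :=
    @factor_premorphism B C (fun z => thetaY (alpha (etaX z))) C_compact.
- move=> z; apply: (@continuous_comp _ _ _ etaX (thetaY \o alpha)).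
    exact: etaXc.
  by apply: continuous_comp; [exact: alpha_c|exact: thYc].
- move=> z; have [a _ az] := alpha_surj (etaY z) I; exists (thetaX a).
  by rewrite thXK az etaYK.
- move=> z; rewrite -thY_psiE -alphaE; congr (thetaY (alpha _)).
  by apply: (can_inj thXK); rewrite etaXK thX_phiE etaXK.
- by rewrite -thX_x thXK alpha_x.
exists (premorphism_class f); apply: eq_exist.
have := PhiE f; rewrite /Phi /= => ->.
by apply: functional_extensionality_dep => a; rewrite /pull fP thXK thYK.
Qed.
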